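(* Let $\Bbbk$ be an algebraically closed field and let $A$ be a finite-dimensional basic $\Bbbk$-algebra with a fixed set of orthogonal primitive idempotents $\{e_\lambda\}_{\lambda\in\Lambda}$ such that $\sum_{\lambda\in\Lambda}e_\lambda=1$. Let $\preccurlyeq$ be a linear order on $\Lambda$ such that $A$ is standardly stratified for $\preccurlyeq$ and the corresponding category $\mathcal{F}({}_{\preccurlyeq}\Delta)$ is closed under cokernels of monomorphisms. Then $\preccurlyeq\,\in\mathcal{L}$, where $\mathcal{L}$ is the set of linear orders on $\Lambda$ produced by the algorithm described in the context.
   Context: All modules are finitely generated left modules; the zero module is regarded as projective. $P_\lambda=Ae_\lambda$, $S_\lambda=P_\lambda/\mathrm{rad}\,P_\lambda$. For a module $M$, $\mathrm{tr}_{P_\lambda}(M)$ is the sum of the images of all homomorphisms $P_\lambda\to M$. Stratification. For a linear order $\preccurlyeq$ on $\Lambda$, the standard module ${}_{\preccurlyeq}\Delta_\lambda$ is the largest quotient of $P_\lambda$ all of whose composition factors $S_\mu$ satisfy $\mu\preccurlyeq\lambda$. $\mathcal{F}({}_{\preccurlyeq}\Delta)$ is the full subcategory of $A$-modules having a finite filtration whose factors are isomorphic to standard modules ${}_{\preccurlyeq}\Delta_\mu$, $\mu\in\Lambda$. $A$ is standardly stratified for $\preccurlyeq$ if for every $\lambda\in\Lambda$ the kernel of $P_\lambda\to{}_{\preccurlyeq}\Delta_\lambda$ has a filtration with factors ${}_{\preccurlyeq}\Delta_\mu$ with $\mu\succ\lambda$. $\mathcal{F}({}_{\preccurlyeq}\Delta)$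 is closed under cokernels of monomorphisms if for every exact sequence $0\to L\to M\to N\to0$ with $L,M\in\mathcal{F}({}_{\preccurlyeq}\Delta)$ one has $N\in\mathcal{F}({}_{\preccurlyeq}\Delta)$. The algorithm. (1) Define $O_1=\{\lambda\in\Lambda\mid\forall\mu\in\Lambda,\ \mathrm{tr}_{P_\lambda}(P_\mu)\cong P_\lambda^{m_\mu}\text{ for some }m_\mu\geqslant0\}$. If $O_1=\emptyset$, the algorithm ends. (2) Otherwise define a partial order $\leqslant'$ on $O_1$ by $\lambda\leqslant'\mu$ if and only if $\mathrm{tr}_{P_\mu}(P_\lambda)\neq0$. (3) Take an element $s_1\in O_1$ that is maximal with respect to $\leqslant'$, and let $\bar{A}=A/Ae_{s_1}A$. (4) Repeat these steps for $\bar{A}$ (with index set $\Lambda\setminus\{s_1\}$ and the images of the remaining idempotents) recursively until the algorithm ends. This yields a chain $s_1,s_2,\ldots,s_t$, and one sets $s_1\succ s_2\succ\cdots\succ s_t$. Let $\tilde{\mathcal{L}}$ be the set of all linear orders obtained in this way (over all possible choices of maximal elements in step (3)), and let $\mathcal{L}\subseteq\tilde{\mathcal{L}}$ be the subset of those of length $t=|\Lambda|$, i.e. those which are linear orders on all of $\Lambda$. *)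

(* Defs.v *)
From HB Require Import structures.
From mathcomp Require Import all_boot all_algebra all_field.
From mathcomp Require Import boolp.

Set Implicit Arguments.
Unset Strict Implicit.
Unset Printing Implicit Defensive.

Import GRing.Theory.
Local Open Scope ring_scope.
Local Open Scope quotient_scope.

(* Modules over [R : pzRingType] are left modules, [lmodType R], and submodules
   of [M] are the structures [submodClosed M].  The base ring may be zero: the
   last quotient in a full run of the algorithm is the zero ring. *)

Section SubQuotient.
Variables (R : pzRingType) (M : lmodType R).

Record submod_of (N : submodClosed M) :=
  Submod { submod_val : M; _ : submod_val \in N }.

Section Sub.
Variable N : submodClosed M.
HB.instance Definition _ := [isSub for @submod_val N].
HB.instance Definition _ := [Choice of submod_of N by <:].
HB.instance Definition _ := [SubChoice_isSubLmodule of submod_of N by <:].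
End Sub.

(* [submodClosed] is stated over semirings and does not inherit [zmodClosed]. *)
Definition submod_pred (N : submodClosed M) : M -> bool := fun x => x \in N.
Fact submod_pred_closed (N : submodClosed M) : zmod_closed (submod_pred N).
Proof. exact: GRing.submod_closedB (GRing.submodClosedP N). Qed.
HB.instance Definition _ (N : submodClosed M) :=
  GRing.isZmodClosed.Build M (submod_pred N) (submod_pred_closed N).
Definition submod_zmod (N : submodClosed M) : zmodClosed M :=
  GRing.ZmodClosed.clone M (submod_pred N) _.

Definition quot_mod (N : submodClosed M) : Type := Quotient.quot (submod_zmod N).

Section Quot.
Variable N : submodClosed M.
HB.instance Definition _ := EqQuotient.on (quot_mod N).
HB.instance Definition _ := GRing.Zmodule.on (quot_mod N).

Definition quot_scale (a : R) (x : quot_mod N) : quot_mod N :=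
  \pi_(quot_mod N) (a *: repr x).

Lemma quot_modP (x y : M) :
  (x - y \in N) = (\pi_(quot_mod N) x == \pi_(quot_mod N) y).
Proof.
rewrite -[RHS](@Quotient.idealrBE M (submod_zmod N) x y).
by rewrite [RHS]unfold_in.
Qed.

Lemma quot_modD (x y : M) :
  \pi_(quot_mod N) (x + y) = \pi_(quot_mod N) x + \pi_(quot_mod N) y.
Proof. exact: Quotient.pi_add. Qed.

Lemma quot_scaleE a (x : M) :
  quot_scale a (\pi_(quot_mod N) x) = \pi_(quot_mod N) (a *: x).
Proof.
apply/eqP; rewrite -quot_modP -scalerBr rpredZ //.
by rewrite quot_modP reprK.
Qed.

Fact quot_scaleA a b x : quot_scale a (quot_scale b x) = quot_scale (a * b) x.
Proof. by rewrite -[x]reprK (quot_scaleE b) !quot_scaleE scalerA. Qed.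
Fact quot_scale1 : left_id 1 quot_scale.
Proof. by move=> x; rewrite -[x]reprK quot_scaleE scale1r. Qed.
Fact quot_scaleDr : right_distributive quot_scale +%R.
Proof.
move=> a x y; rewrite -[x]reprK -[y]reprK -quot_modD !quot_scaleE.
by rewrite scalerDr quot_modD.
Qed.
Fact quot_scaleDl x : {morph quot_scale^~ x : a b / a + b}.
Proof.
by move=> a b; rewrite -[x]reprK !quot_scaleE scalerDl quot_modD.
Qed.
HB.instance Definition _ := GRing.Zmodule_isLmodule.Build R (quot_mod N)
  quot_scaleA quot_scale1 quot_scaleDr quot_scaleDl.
End Quot.

(* [N :&: N'], as a submodule of [N]; so [subquot N' N] is [N / N'] when
   [N' <= N]. *)
Definition submod_cap_pred (N' N : submodClosed M) : submod_of N -> bool :=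
  fun x => val x \in N'.

Fact submod_cap_closed N' N : subsemimod_closed (@submod_cap_pred N' N).
Proof.
split; first split.
- by rewrite unfold_in /submod_cap_pred raddf0 rpred0.
- by move=> x y xN yN; rewrite unfold_in /submod_cap_pred raddfD rpredD.
- by move=> a x xN; rewrite unfold_in /submod_cap_pred linearZ rpredZ.
Qed.
HB.instance Definition _ N' N :=
  GRing.isSubmodClosed.Build R (submod_of N) (@submod_cap_pred N' N)
    (submod_cap_closed N' N).
Definition submod_cap (N' N : submodClosed M) : submodClosed (submod_of N) :=
  GRing.SubmodClosed.clone R (submod_of N) (@submod_cap_pred N' N) _.

End SubQuotient.

Section ModuleNotions.
Variables (R : pzRingType) (M : lmodType R).

Definition subquot (N' N : submodClosed M) : lmodType R :=
  quot_mod (submod_cap N' N).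

Definition fin_gen : Prop :=
  exists (n : nat) (g : 'I_n -> M),
    forall x, exists c : 'I_n -> R, x = \sum_i c i *: g i.

Definition simple_mod : Prop :=
  (exists x : M, x != 0) /\
  (forall N : submodClosed M,
     (forall x, x \in N -> x = 0) \/ (forall x, x \in N)).

Definition maximal_submod (N : submodClosed M) : Prop :=
  (exists x, x \notin N) /\
  (forall N' : submodClosed M, {subset N <= N'} ->
     {subset N' <= N} \/ (forall x, x \in N')).

Definition rad_pred : M -> bool :=
  fun x => `[< forall N : submodClosed M, maximal_submod N -> x \in N >].

Fact rad_closed : subsemimod_closed rad_pred.
Proof.
split; first split.
- by apply/asboolP => N _; exact: rpred0.
- move=> x y /asboolP xr /asboolP yr; apply/asboolP => N maxN.
  by rewrite rpredD ?xr ?yr.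
- by move=> a x /asboolP xr; apply/asboolP => N maxN; rewrite rpredZ ?xr.
Qed.
HB.instance Definition _ := GRing.isSubmodClosed.Build R M rad_pred rad_closed.
Definition rad : submodClosed M := GRing.SubmodClosed.clone R M rad_pred _.

Definition is_filtration (n : nat) (F : nat -> submodClosed M) : Prop :=
  [/\ forall x, x \in F 0%N -> x = 0,
      forall x, x \in F n
    & forall i, (i < n)%N -> {subset F i <= F i.+1}].

End ModuleNotions.

Section Homs.
Variable R : pzRingType.
Implicit Types L M N U V : lmodType R.

Definition mod_iso U V : Prop := exists f : {linear U -> V}, bijective f.

Definition composition_factor M S : Prop :=
  exists (n : nat) (F : nat -> submodClosed M),
    [/\ is_filtration n F,
        forall i, (i < n)%N -> simple_mod (subquot (F i) (F i.+1))
      & exists2 i, (i < n)%N & mod_iso (subquot (F i) (F i.+1)) S].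

Definition trace_pred U M : M -> bool :=
  fun x => `[< exists (n : nat) (f : 'I_n -> {linear U -> M}) (u : 'I_n -> U),
                 x = \sum_i f i (u i) >].

Fact trace_closed U M : subsemimod_closed (@trace_pred U M).
Proof.
split; first split.
- apply/asboolP; exists 0%N, (fun=> \0 : {linear U -> M}), (fun=> 0).
  by rewrite big_ord0.
- move=> x y /asboolP[n [f [u ->]]] /asboolP[m [g [v ->]]]; apply/asboolP.
  exists (n + m)%N, (fun i => match split i with inl j => f j | inr j => g j end).
  exists (fun i => match split i with inl j => u j | inr j => v j end).
  rewrite big_split_ord; congr (_ + _); apply: eq_bigr => i _.
    by rewrite (unsplitK (inl _ i)).
  by rewrite (unsplitK (inr _ i)).
- move=> a x /asboolP[n [f [u ->]]]; apply/asboolP.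
  exists n, f, (fun i => a *: u i).
  by rewrite scaler_sumr; apply: eq_bigr => i _; rewrite linearZ.
Qed.
HB.instance Definition _ U M :=
  GRing.isSubmodClosed.Build R M (@trace_pred U M) (@trace_closed U M).
Definition trace U M : submodClosed M :=
  GRing.SubmodClosed.clone R M (@trace_pred U M) _.

Definition short_exact L M N (f : {linear L -> M}) (g : {linear M -> N}) :=
  [/\ injective f, forall y, (exists x, g x = y)
    & forall y, g y = 0 <-> exists x, f x = y].

End Homs.

Section Idempotents.
Variable R : pzRingType.

Definition primitive_idem (e : R) : Prop :=
  [/\ e * e = e, e != 0
    & forall f g : R, f * f = f -> g * g = g -> f * g = 0 -> g * f = 0 ->
        e = f + g -> f = 0 \/ g = 0].

Definition left_ideal_pred (e : R) : R^o -> bool :=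
  fun x => `[< exists a : R, x = a * e >].

Fact left_ideal_closed e : subsemimod_closed (left_ideal_pred e).
Proof.
split; first split.
- by apply/asboolP; exists 0; rewrite mul0r.
- move=> x y /asboolP[a ->] /asboolP[b ->]; apply/asboolP.
  by exists (a + b); rewrite mulrDl.
- by move=> c x /asboolP[a ->]; apply/asboolP; exists (c * a); rewrite -mulrA.
Qed.
HB.instance Definition _ e :=
  GRing.isSubmodClosed.Build R R^o (left_ideal_pred e) (left_ideal_closed e).
Definition left_ideal (e : R) : submodClosed R^o :=
  GRing.SubmodClosed.clone R R^o (left_ideal_pred e) _.

Definition two_sided_ideal_pred (e : R) : R -> bool :=
  fun x => `[< exists (n : nat) (a b : 'I_n -> R), x = \sum_i a i * e * b i >].

Fact two_sided_ideal_closed e : zmod_closed (two_sided_ideal_pred e).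
Proof.
split; first by apply/asboolP; exists 0%N, (fun=> 0), (fun=> 0); rewrite big_ord0.
move=> x y /asboolP[n [a [b ->]]] /asboolP[m [c [d ->]]]; apply/asboolP.
exists (n + m)%N, (fun i => match split i with inl j => a j | inr j => - c j end).
exists (fun i => match split i with inl j => b j | inr j => d j end).
rewrite big_split_ord -sumrN; congr (_ + _); apply: eq_bigr => i _.
  by rewrite (unsplitK (inl _ i)).
by rewrite (unsplitK (inr _ i)) !mulNr.
Qed.
HB.instance Definition _ e :=
  GRing.isZmodClosed.Build R (two_sided_ideal_pred e) (two_sided_ideal_closed e).
Definition two_sided_ideal (e : R) : zmodClosed R :=
  GRing.ZmodClosed.clone R (two_sided_ideal_pred e) _.

Lemma two_sided_idealMl e a x :
  x \in two_sided_ideal e -> a * x \in two_sided_ideal e.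
Proof.
move=> /asboolP[n [c [d ->]]]; apply/asboolP.
exists n, (fun i => a * c i), d; rewrite mulr_sumr.
by apply: eq_bigr => i _; rewrite !mulrA.
Qed.
Lemma two_sided_idealMr e a x :
  x \in two_sided_ideal e -> x * a \in two_sided_ideal e.
Proof.
move=> /asboolP[n [c [d ->]]]; apply/asboolP.
exists n, c, (fun i => d i * a); rewrite mulr_suml.
by apply: eq_bigr => i _; rewrite !mulrA.
Qed.

Definition quot_ring (e : R) : Type := Quotient.quot (two_sided_ideal e).

Section QuotRing.
Variable e : R.
HB.instance Definition _ := EqQuotient.on (quot_ring e).
HB.instance Definition _ := GRing.Zmodule.on (quot_ring e).
Local Notation Q := (quot_ring e).

Definition quot_one : Q := \pi_Q 1.
Definition quot_mul (x y : Q) : Q := \pi_Q (repr x * repr y).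

Lemma quot_ringP (x y : R) :
  (x - y \in two_sided_ideal e) = (\pi_Q x == \pi_Q y).
Proof. exact: Quotient.idealrBE. Qed.

Lemma quot_ringD (x y : R) : \pi_Q (x + y) = \pi_Q x + \pi_Q y.
Proof. exact: Quotient.pi_add. Qed.

Lemma quot_mulE (x y : R) : quot_mul (\pi_Q x) (\pi_Q y) = \pi_Q (x * y).
Proof.
apply/eqP; rewrite -quot_ringP.
set x' := repr _; set y' := repr _.
have -> : x' * y' - x * y = (x' - x) * y' + x * (y' - y).
  by rewrite mulrBl mulrBr addrA subrK.
apply: rpredD.
  by apply: two_sided_idealMr; rewrite quot_ringP reprK.
by apply: two_sided_idealMl; rewrite quot_ringP reprK.
Qed.

Fact quot_mulA : associative quot_mul.
Proof.
move=> x y z; rewrite -[x]reprK -[y]reprK -[z]reprK.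
move: (repr x) (repr y) (repr z) => a b c.
rewrite (quot_mulE b c) (quot_mulE a b).
by rewrite (quot_mulE a (b * c)) (quot_mulE (a * b) c) mulrA.
Qed.
Fact quot_mul1l : left_id quot_one quot_mul.
Proof. by move=> x; rewrite -[x]reprK quot_mulE mul1r. Qed.
Fact quot_mul1r : right_id quot_one quot_mul.
Proof. by move=> x; rewrite -[x]reprK quot_mulE mulr1. Qed.
Fact quot_mulDl : left_distributive quot_mul +%R.
Proof.
move=> x y z; rewrite -[x]reprK -[y]reprK -[z]reprK.
by rewrite -quot_ringD !quot_mulE mulrDl quot_ringD.
Qed.
Fact quot_mulDr : right_distributive quot_mul +%R.
Proof.
move=> x y z; rewrite -[x]reprK -[y]reprK -[z]reprK.
by rewrite -quot_ringD !quot_mulE mulrDr quot_ringD.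
Qed.
HB.instance Definition _ := GRing.Zmodule_isPzRing.Build Q
  quot_mulA quot_mul1l quot_mul1r quot_mulDl quot_mulDr.
End QuotRing.

End Idempotents.

Definition linear_order (T : Type) (le : rel T) : Prop :=
  [/\ reflexive le, antisymmetric le, transitive le & total le].

Section Stratification.
Variables (Lam : finType) (R : pzRingType) (e : Lam -> R).

Definition Pmod (l : Lam) : lmodType R := submod_of (left_ideal (e l)).
Definition Smod (l : Lam) : lmodType R := quot_mod (rad (Pmod l)).

Definition complete_primitive_idems : Prop :=
  [/\ forall l, primitive_idem (e l),
      forall l m, l != m -> e l * e m = 0
    & \sum_l e l = 1].

(* Basic, in terms of a complete set of primitive orthogonal idempotents. *)
Definition basic : Prop :=
  forall l m, mod_iso (Pmod l) (Pmod m) -> l = m.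

Variable le : rel Lam.

(* The kernel of [P_l -> Delta_l]: the quotient being the largest admissible
   one, its kernel is the smallest admissible submodule. *)
Definition std_kernel_pred (l : Lam) : Pmod l -> bool :=
  fun x => `[< forall N : submodClosed (Pmod l),
     (forall m, composition_factor (quot_mod N) (Smod m) -> le m l) ->
     x \in N >].

Fact std_kernel_closed l : subsemimod_closed (@std_kernel_pred l).
Proof.
split; first split.
- by apply/asboolP => N _; exact: rpred0.
- move=> x y /asboolP xr /asboolP yr; apply/asboolP => N hN.
  by rewrite rpredD ?xr ?yr.
- by move=> a x /asboolP xr; apply/asboolP => N hN; rewrite rpredZ ?xr.
Qed.
HB.instance Definition _ l :=
  GRing.isSubmodClosed.Build R (Pmod l) (@std_kernel_pred l)
    (std_kernel_closed l).
Definition std_kernel (l : Lam) : submodClosed (Pmod l) :=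
  GRing.SubmodClosed.clone R (Pmod l) (@std_kernel_pred l) _.

Definition standard (l : Lam) : lmodType R := quot_mod (std_kernel l).

Definition std_filtered (B : pred Lam) (M : lmodType R) : Prop :=
  exists (n : nat) (F : nat -> submodClosed M),
    is_filtration n F /\
    forall i, (i < n)%N ->
      exists2 m, B m & mod_iso (subquot (F i) (F i.+1)) (standard m).

Definition catF (M : lmodType R) : Prop := fin_gen M /\ std_filtered predT M.

Definition standardly_stratified : Prop :=
  forall l, std_filtered [pred m | le l m && (m != l)]
              (submod_of (std_kernel l)).

Definition catF_closed_coker : Prop :=
  forall (L M N : lmodType R) (f : {linear L -> M}) (g : {linear M -> N}),
    fin_gen N -> short_exact f g -> catF L -> catF M -> catF N.

End Stratification.

Section Algorithm.
Variable Lam : finType.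

Section Step.
Variables (R : pzRingType) (e : Lam -> R) (J : {set Lam}).

Definition O1 : {set Lam} :=
  [set l in J | `[< forall m, m \in J -> exists k : nat,
     mod_iso (submod_of (trace (Pmod e l) (Pmod e m)))
             {ffun 'I_k -> Pmod e l} >]].

Definition le' (l m : Lam) : Prop :=
  exists2 x, x \in trace (Pmod e m) (Pmod e l) & x != 0.

Definition maximal_O1 (s : Lam) : Prop :=
  s \in O1 /\ forall m, m \in O1 -> le' s m -> m = s.

End Step.

(* [algorithm_run s R e J]: on the algebra [R], with index set [J] and
   idempotents [e l] for [l] in [J], the algorithm can choose successively the
   elements of [s] and then end. *)
Fixpoint algorithm_run (s : seq Lam) (R : pzRingType) (e : Lam -> R)
    (J : {set Lam}) : Prop :=
  if s is s1 :: s' then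
    maximal_O1 e J s1 /\
    algorithm_run s' (fun l => \pi_(quot_ring (e s1)) (e l)) (J :\ s1)
  else O1 e J = set0.

(* The order [s_1 > s_2 > ... > s_t] on the members of the chain [s]. *)
Definition chain_order (s : seq Lam) : rel Lam :=
  fun l m => [&& l \in s, m \in s & (index m s <= index l s)%N].

Definition calL (R : pzRingType) (e : Lam -> R) (le : rel Lam) : Prop :=
  exists s : seq Lam,
    [/\ algorithm_run s e [set: Lam], size s = #|Lam| & le =2 chain_order s].

End Algorithm.

(* Main.v *)
(* The maximal element s of the order lies in O_1 because in a standard
   filtration of a module the factors Delta_s = P_s are projective: they split
   off, and the trace of P_s is free on them.  It is maximal for <=': if another
   m in O_1 had a nonzero trace in P_s, then P_m would embed in P_s; the
   cokernel, which is filtered by closedness under cokernels, would then surject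
   onto the Delta at its top, which is Delta_s = P_s, although it is a proper
   quotient of P_s.  Both arguments work for the quotients of the algebra met by
   the algorithm, whose modules are the A-modules killed by the idempotents
   already removed; so everything below takes place over A itself. *)

(* What passes from one quotient algebra to the next is that its projectives, seen as modules over
   the original algebra A, have standard filtrations. Standard stratification gives this for A
   itself, and it survives because a split trace can be factored out of a filtered module.
   Closedness under cokernels is thus applied to A-modules only and need not be inherited by the
   quotient algebras. Each projective is handled through a generator and its annihilator, so that
   comparing it with the projective over the quotient ring is a comparison of ideals. That a proper
   quotient of Delta_s cannot surject onto Delta_s is not proved by counting lengths: it comes from
   the corner rings [e_l A e_l], whose elements are nilpotent or invertible. Composition series
   occur only because standard modules are defined by composition factors; they serve to show that
   the kernel of [P_l -> Delta_l] is cut out by the ideal of the idempotents above [l]. *)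
From HB Require Import structures.
From mathcomp Require Import all_boot all_algebra all_field.
From mathcomp Require Import boolp.
Require Import Defs.

Set Implicit Arguments.
Unset Strict Implicit.
Unset Printing Implicit Defensive.

Import GRing.Theory.
Local Open Scope ring_scope.
Local Open Scope quotient_scope.

(** * Submodules, quotients and cyclic modules *)

Section Modules.
Variable R : pzRingType.
Implicit Types (L M U V : lmodType R).

(** Submodules, and likewise linear maps and quotients below, are obtained by existence, so that
    later proofs see a characterisation of elements and never the packed structures. *)
Lemma submod_ex M (P : M -> Prop) :
  P 0 -> (forall x y, P x -> P y -> P (x + y)) ->
  (forall a x, P x -> P (a *: x)) ->
  exists N : submodClosed M, forall x, x \in N <-> P x.
Proof.
move=> P0 PD PZ.
pose p : M -> bool := fun x => `[< P x >].
have pP : subsemimod_closed p.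
  split; first split.
  - exact/asboolP.
  - by move=> x y /asboolP xP /asboolP yP; apply/asboolP; apply: PD.
  - by move=> a x /asboolP xP; apply/asboolP; apply: PZ.
pose N : submodClosed M := HB.pack p (GRing.isSubmodClosed.Build R M p pP).
by exists N => x; split=> [/asboolP|xP] //; apply/asboolP.
Qed.

Lemma linear_ex U V (f : U -> V) :
  linear f -> exists g : {linear U -> V}, forall x, g x = f x.
Proof.
move=> fL.
pose g : {linear U -> V} := HB.pack f (GRing.isLinear.Build R U V *:%R f fL).
by exists g.
Qed.

Section QuotMap.
Variables (M : lmodType R) (N : submodClosed M).

Definition quot_map (x : M) : quot_mod N := \pi_(quot_mod N) x.

Fact quot_map_linear : linear quot_map.
Proof. by move=> a x y; rewrite /quot_map quot_modD -quot_scaleE. Qed.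
HB.instance Definition _ :=
  GRing.isLinear.Build R M (quot_mod N) *:%R quot_map quot_map_linear.

Lemma quot_map_surj y : exists x, quot_map x = y.
Proof. by exists (repr y); rewrite /quot_map reprK. Qed.

Lemma quot_map_eq0 x : quot_map x = 0 <-> x \in N.
Proof.
rewrite -{2}[x]subr0 quot_modP -/(quot_map x) -/(quot_map 0) linear0.
by split=> [->|/eqP].
Qed.
End QuotMap.

Lemma quot_map_ex M (N : submodClosed M) : exists g : {linear M -> quot_mod N},
  (forall y, exists x, g x = y) /\ (forall x, g x = 0 <-> x \in N).
Proof.
exists (quot_map N : {linear _ -> _}); split; first exact: quot_map_surj.
exact: quot_map_eq0.
Qed.

Lemma quot_mod_ex M (P : M -> Prop) :
  P 0 -> (forall x y, P x -> P y -> P (x + y)) ->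
  (forall a x, P x -> P (a *: x)) ->
  exists (Q : lmodType R) (g : {linear M -> Q}),
    (forall y, exists x, g x = y) /\ (forall x, g x = 0 <-> P x).
Proof.
move=> P0 PD PZ; have [N NP] := submod_ex P0 PD PZ.
have [g [gS g0]] := quot_map_ex N; exists (quot_mod N), g.
by split=> // x; rewrite g0.
Qed.

Definition generates M (v : M) : Prop := forall x, exists a : R, x = a *: v.

Lemma cyclic_linear U V (u : U) (v : V) :
  generates u -> (forall a : R, a *: u = 0 -> a *: v = 0) ->
  exists f : {linear U -> V}, forall a, f (a *: u) = a *: v.
Proof.
move=> uG uv; have [c cE] := choice uG.
have cv a b : a *: u = b *: u -> a *: v = b *: v.
  move=> ab; apply/eqP; rewrite -subr_eq0 -scalerBl; apply/eqP/uv.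
  by rewrite scalerBl ab subrr.
have [|f fE] := @linear_ex U V (fun x => c x *: v).
  move=> a x y; rewrite scalerA -scalerDl; apply: cv.
  by rewrite scalerDl -scalerA -!cE.
by exists f => a; rewrite fE; apply: cv; rewrite -cE.
Qed.

Lemma linear_inv U V (f : {linear U -> V}) :
  injective f -> (forall y, exists x, f x = y) ->
  exists g : {linear V -> U}, cancel f g /\ cancel g f.
Proof.
move=> fI fS; have [g gE] := choice fS.
have [|h hE] := @linear_ex V U g.
  by move=> a x y; apply: fI; rewrite linearP !gE.
by exists h; split=> x; rewrite hE ?gE //; apply: fI; rewrite gE.
Qed.

Lemma mod_iso_sym U V : mod_iso U V -> mod_iso V U.
Proof.
case=> f [g fK gK].
have [|y|h [fh hf]] := @linear_inv U V f; first exact: can_inj fK.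
  by exists (g y).
by exists h, f.
Qed.

Lemma bij_mod_iso U V (f : {linear U -> V}) :
  injective f -> (forall y, exists x, f x = y) -> mod_iso U V.
Proof.
by move=> fI fS; have [g [fg gf]] := linear_inv fI fS; exists f, g.
Qed.

Lemma linear_inj0 U V (f : {linear U -> V}) :
  (forall x, f x = 0 -> x = 0) -> injective f.
Proof.
move=> f0 x y fxy; apply/eqP; rewrite -subr_eq0; apply/eqP/f0.
by rewrite linearB fxy subrr.
Qed.

Lemma cyclic_mod_iso U V (u : U) (v : V) :
  generates u -> generates v ->
  (forall a : R, a *: u = 0 <-> a *: v = 0) -> mod_iso U V.
Proof.
move=> uG vG uv; have [|f fE] := cyclic_linear (v := v) uG.
  by move=> a /uv.
apply: (@bij_mod_iso _ _ f).
  by apply: linear_inj0 => x; have [a ->] := uG x; rewrite fE => /uv.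
by move=> y; have [a ->] := vG y; exists (a *: u).
Qed.

Lemma submod_of_ex M (N : submodClosed M) :
  exists j : {linear submod_of N -> M},
    injective j /\ forall x, x \in N <-> exists y, j y = x.
Proof.
exists (val : {linear _ -> _}); split; first exact: val_inj.
move=> x; split=> [xN|[y <-]]; last exact: valP.
by exists (Submod xN).
Qed.

Lemma subquot_ex M (N' N : submodClosed M) :
  exists (L : lmodType R) (j : {linear L -> M}) (q : {linear L -> subquot N' N}),
  [/\ forall x, x \in N <-> exists y, j y = x,
      forall y, exists x, q x = y & forall x, q x = 0 <-> j x \in N'].
Proof.
exists (submod_of N), (val : {linear _ -> _}).
exists (quot_map (submod_cap N' N) : {linear _ -> _}); split.
- move=> x; split=> [xN|[y <-]]; last exact: valP.
  by exists (Submod xN).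
- by move=> y; exact: quot_map_surj.
- by move=> x; rewrite quot_map_eq0.
Qed.

(** A cyclic module is determined by the annihilator [I] of a generator, so an isomorphism with it
    amounts to one element [w] of [M] with annihilator [I] modulo [N']. *)
Lemma subquot_mod_isoP M (N' N : submodClosed M) V (v : V) (I : R -> Prop) :
  generates v -> (forall a, a *: v = 0 <-> I a) ->
  mod_iso (subquot N' N) V <->
  exists w : M, [/\ w \in N, forall x, x \in N -> exists a : R, x - a *: w \in N'
             & forall a : R, a *: w \in N' <-> I a].
Proof.
move=> vG vI; have [L [j [q [jN qS q0]]]] := subquot_ex N' N.
move: (subquot N' N) q qS q0 => Q q qS q0; split.
  move=> /mod_iso_sym[f [g fg gf]].
  have [x xE] := qS (f v).
  exists (j x); split=> [|y yN|a].
  - by apply/jN; exists x.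
  - have [y' <-] := (jN y).1 yN.
    have [a aE] := vG (g (q y')); exists a.
    rewrite -linearZ -linearB; apply/q0.
    by rewrite linearB linearZ /= xE -linearZ -aE gf subrr.
  - rewrite -linearZ -q0 linearZ /= xE -linearZ -vI.
    split=> [fa|->]; last by rewrite linear0.
    by rewrite -[_ *: v]fg fa -(linear0 f) fg.
case=> w [wN wG wI]; have [w' w'E] := (jN w).1 wN.
apply: (cyclic_mod_iso (u := q w') (v := v)) => //.
  move=> y; have [x <-] := qS y.
  have [|a aE] := wG (j x); first by apply/jN; exists x.
  exists a; apply: subr0_eq; rewrite -linearZ -linearB; apply/q0.
  by rewrite linearB linearZ /= w'E.
by move=> a; rewrite vI -wI -linearZ q0 linearZ /= w'E.
Qed.

End Modules.

(** * Standard filtrations and the trace of a projective *)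

Section StandardFiltrations.
Variables (Lam : finType) (R : pzRingType) (e : Lam -> R).
Hypothesis eI : forall l, e l * e l = e l.
Implicit Types (U : {set Lam}) (L M N Q : lmodType R).

(** The ideal generated by the [e l] with [l] in [U]. The iterated quotients of the algorithm all
    become quotients of the one ring [R] by ideals of this form. *)
Inductive idem_ideal U : R -> Prop :=
| idem_ideal0 : idem_ideal U 0
| idem_idealD x y : idem_ideal U x -> idem_ideal U y -> idem_ideal U (x + y)
| idem_ideal_gen l a b : l \in U -> idem_ideal U (a * e l * b).

Lemma idem_idealMl U a x : idem_ideal U x -> idem_ideal U (a * x).
Proof.
elim=> [|y z _ IHy _ IHz|l b c lU]; first by rewrite mulr0; exact: idem_ideal0.
  by rewrite mulrDr; exact: idem_idealD.
by rewrite !mulrA; apply: idem_ideal_gen.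
Qed.

Lemma idem_idealMr U a x : idem_ideal U x -> idem_ideal U (x * a).
Proof.
elim=> [|y z _ IHy _ IHz|l b c lU]; first by rewrite mul0r; exact: idem_ideal0.
  by rewrite mulrDl; exact: idem_idealD.
by rewrite -mulrA; apply: idem_ideal_gen.
Qed.

Lemma idem_ideal_sum U n (x : 'I_n -> R) :
  (forall i, idem_ideal U (x i)) -> idem_ideal U (\sum_i x i).
Proof.
move=> xU; elim/big_rec: _ => [|i y _ yU]; first exact: idem_ideal0.
exact: idem_idealD.
Qed.

Lemma idem_idealS U U' x : {subset U <= U'} -> idem_ideal U x -> idem_ideal U' x.
Proof.
move=> UU'; elim=> [|y z _ IHy _ IHz|l b c lU]; first exact: idem_ideal0.
  exact: idem_idealD.
exact/idem_ideal_gen/UU'.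
Qed.

Lemma idem_ideal_set0 x : idem_ideal set0 x -> x = 0.
Proof.
by elim=> // [y z _ -> _ ->|l ? ?]; rewrite ?addr0 ?inE.
Qed.

(** These are the modules over the quotient of [R] by the ideal of [U], kept as [R]-modules. *)
Definition killed U M : Prop := forall l (x : M), l \in U -> e l *: x = 0.

Lemma killed_ideal U M a (x : M) : killed U M -> idem_ideal U a -> a *: x = 0.
Proof.
move=> MU; elim=> [|b c _ IHb _ IHc|l b c lU]; first by rewrite scale0r.
  by rewrite scalerDl IHb IHc addr0.
by rewrite -!scalerA MU // scaler0.
Qed.

(* [v] presents [M] as the quotient of [R e_l] by its submodule generated by
   the traces of the [R e_u] with [u] in [U]. *)
Definition cyclic_at U l M (v : M) : Prop :=
  generates v /\ forall a : R, a *: v = 0 <-> idem_ideal U (a * e l).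

Lemma cyclic_at_idem U l M (v : M) : cyclic_at U l v -> e l *: v = v.
Proof.
case=> _ vU; apply/esym/subr0_eq; rewrite -[X in X - _]scale1r -scalerBl.
by apply/vU; rewrite mulrBl mul1r eI subrr; exact: idem_ideal0.
Qed.

Lemma cyclic_at_killed U l M (v : M) : cyclic_at U l v -> killed U M.
Proof.
case=> vG vU u x uU; have [a ->] := vG x; rewrite scalerA; apply/vU.
by rewrite -[e u]mul1r -mulrA; apply: idem_ideal_gen.
Qed.

Variable le : rel Lam.
Definition above l : {set Lam} := [set m | le l m && (m != l)].

(* The inductive form of [std_filtered]: [v] generates the top factor
   [M / f L], and [cyclic_at (above m) m] describes [standard m]. *)
Inductive filt : lmodType R -> Prop :=
| filt_zero M : (forall x : M, x = 0) -> filt M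
| filt_step L M (f : {linear L -> M}) m (v : M) :
    injective f -> filt L ->
    (forall x, exists (a : R) y, x = a *: v + f y) ->
    (forall a : R, (exists y, a *: v = f y) <-> idem_ideal (above m) (a * e m)) ->
    filt M.

Definition combination M n (x : 'I_n -> M) (z : M) : Prop :=
  exists c : 'I_n -> R, z = \sum_i c i *: x i.

Lemma combination0 M n (x : 'I_n -> M) : combination x 0.
Proof. by exists (fun=> 0); rewrite big1 // => i _; rewrite scale0r. Qed.

Lemma combinationD M n (x : 'I_n -> M) y z :
  combination x y -> combination x z -> combination x (y + z).
Proof.
move=> [c ->] [d ->]; exists (fun i => c i + d i).
by rewrite -big_split; apply: eq_bigr => i _; rewrite scalerDl.
Qed.

Lemma combinationZ M n (x : 'I_n -> M) a z :
  combination x z -> combination x (a *: z).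
Proof.
move=> [c ->]; exists (fun i => a * c i).
by rewrite scaler_sumr; apply: eq_bigr => i _; rewrite scalerA.
Qed.

Definition cons_fun (T : Type) n (x0 : T) (x : 'I_n -> T) (i : 'I_n.+1) : T :=
  if unlift ord0 i is Some j then x j else x0.

Lemma sum_cons_fun M n (c : 'I_n.+1 -> R) (x0 : M) (x : 'I_n -> M) :
  \sum_i c i *: cons_fun x0 x i = c ord0 *: x0 + \sum_i c (lift ord0 i) *: x i.
Proof.
rewrite big_ord_recl /cons_fun unlift_none; congr (_ + _).
by apply: eq_bigr => i _; rewrite liftK.
Qed.

Lemma combination_cons M n (x0 : M) (x : 'I_n -> M) z :
  combination (cons_fun x0 x) z <-> exists a : R, combination x (z - a *: x0).
Proof.
split=> [[c ->]|[a [c cE]]].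
  exists (c ord0), (fun i => c (lift ord0 i)).
  by rewrite sum_cons_fun addrAC subrr add0r.
exists (cons_fun a c); rewrite sum_cons_fun /cons_fun unlift_none.
under eq_bigr => i _ do rewrite liftK.
by rewrite -cE addrC subrK.
Qed.

(** The second clause makes the [x i] generate the trace [R e_s M]; the third is freeness over the
    quotient of [R] by the ideal of [above s]. *)
Definition trace_basis s M n (x : 'I_n -> M) : Prop :=
  [/\ forall i, e s *: x i = x i,
      forall y, combination x (e s *: y)
    & forall c : 'I_n -> R, \sum_i c i *: x i = 0 ->
        forall i, idem_ideal (above s) (c i * e s)].

Hypothesis le_total : forall l m, l != m -> ~~ le l m -> le m l.

(* If the top factor has index [s] it splits off, the standard module at [s]
   being projective among modules killed by the idempotents above [s]. *)
Lemma filt_trace s M : filt M -> killed (above s) M ->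
  exists n (x : 'I_n -> M), trace_basis s x /\
    forall Q (g : {linear M -> Q}), (forall y, exists x, g x = y) ->
      (forall z, g z = 0 <-> combination x z) -> filt Q.
Proof.
elim=> {M} [M M0 _|L M f m v fI fL IH vS vU Ms].
  exists 0%N, (fun=> 0); split.
    split=> [[]|y|c _ []] //; exists (fun=> 0).
    by rewrite big_ord0.
  move=> Q g gS _; apply: filt_zero => y; have [x <-] := gS y.
  by rewrite (M0 x) linear0.
have Ls : killed (above s) L.
  by move=> u y us; apply: fI; rewrite linearZ linear0; apply: Ms.
have [n [x [[xs xspan xfree] xQ]]] := IH Ls.
have fcomb z : combination x z -> combination (fun i => f (x i)) (f z).
  move=> [c ->]; exists c; rewrite linear_sum.
  by apply: eq_bigr => i _; rewrite linearZ.
have combf z : combination (fun i => f (x i)) z ->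
    exists2 y, z = f y & combination x y.
  move=> [c ->]; exists (\sum_i c i *: x i); last by exists c.
  by rewrite linear_sum; apply: eq_bigr => i _; rewrite linearZ.
have [sm|sm] := eqVneq m s.
  subst m.
  (* The generator [v] may be replaced by [e s *: v], which represents the same class modulo
     [f L]. *)
  have svv : exists y, v - e s *: v = f y.
    have /vU[y yE] : idem_ideal (above s) ((1 - e s) * e s).
      by rewrite mulrBl mul1r eI subrr; exact: idem_ideal0.
    by exists y; rewrite -yE scalerBl scale1r.
  (* The splitting: a multiple of [e s *: v] that falls into [f L] has its coefficient in the ideal
     of [above s], which kills [M], so it is zero. *)
  have vfree (a : R) y : a *: (e s *: v) = f y ->
      a *: (e s *: v) = 0 /\ idem_ideal (above s) (a * e s).
    rewrite scalerA => ay.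
    have aI : idem_ideal (above s) (a * e s).
      by rewrite -[a * e s]mulr1 -[e s]eI mulr1 mulrA; apply/vU; exists y.
    by split=> //; apply: killed_ideal aI.
  exists n.+1, (cons_fun (e s *: v) (fun i => f (x i))); split.
    split=> [i|y|c c0].
    - rewrite /cons_fun; case: unliftP => [j|] _; last by rewrite scalerA eI.
      by rewrite -linearZ xs.
    - have [a [z ->]] := vS y.
      have [t tE] := svv.
      apply/combination_cons; exists (e s * a).
      have -> : e s *: (a *: v + f z) - (e s * a) *: (e s *: v) =
                f (e s *: (a *: t + z)).
        have -> : f (e s *: (a *: t + z)) = e s *: (a *: f t + f z).
          by rewrite linearZ linearD linearZ.
        rewrite -tE !scalerDr !scalerN !scalerA.
        by rewrite addrAC.
      exact: fcomb.
    - move: c0; rewrite sum_cons_fun => c0.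
      pose y := \sum_i c (lift ord0 i) *: x i.
      have yE : \sum_i c (lift ord0 i) *: f (x i) = f y.
        by rewrite linear_sum; apply: eq_bigr => i _; rewrite linearZ.
      rewrite yE in c0.
      have [|v0 vI] := vfree (c ord0) (- y).
        by apply/eqP; rewrite linearN -addr_eq0 c0.
      have y0 : y = 0 by apply: fI; rewrite linear0 -c0 v0 add0r.
      move=> i; case: (unliftP ord0 i) => [j ->|-> //].
      exact: (xfree (fun i => c (lift ord0 i))).
  (* The split factor lies in the trace, so the quotient of [M] by its trace is already the quotient
     of [L] by the trace of [L]. *)
  move=> Q g gS g0.
  apply: (xQ Q [the {linear L -> Q} of g \o f]).
    move=> y; have [z <-] := gS y; have [a [t ->]] := vS z.
    have [u uE] := svv; exists (a *: u + t).
    rewrite /= linearD linearZ /= -uE; apply: subr0_eq; rewrite -linearB.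
    apply/g0/combination_cons; exists (- a).
    rewrite scaleNr opprK scalerBr opprD addrACA subrr addr0 addrAC subrK subrr.
    exact: combination0.
  move=> z; rewrite /= g0 combination_cons; split=> [[a]|zx]; last first.
    by exists 0; rewrite scale0r subr0; apply: fcomb.
  move=> /combf[y yE yx].
  have [|v0 _] := vfree a (z - y).
    by rewrite linearB -yE opprB addrC subrK.
  by move: yE; rewrite v0 subr0 => /fI ->.
(* The top factor adds nothing to the trace. Either [s] is above [m], and [e s] kills Delta_m; or
   [m] is above [s], so [e m] kills [M] and [v] already lies in [f L]. *)
have sL (y : M) : exists z, e s *: y = f z.
  have [a [t ->]] := vS y.
  suff [z zE] : exists z, e s *: (a *: v) = f z.
    by exists (z + e s *: t); rewrite scalerDr linearD linearZ zE.
  rewrite scalerA.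
  have [sm'|ms'] := boolP (le m s).
    apply/vU; rewrite -mulrA -[e s]mul1r -mulrA mulrA; apply: idem_ideal_gen.
    by rewrite inE sm' eq_sym.
  have ms : m \in above s by rewrite inE sm andbT le_total.
  suff [z zE] : exists z, 1 *: v = f z.
    by exists ((e s * a) *: z); rewrite linearZ -zE scale1r.
  have [z zE] : exists z, (1 - e m) *: v = f z.
    by apply/vU; rewrite mulrBl mul1r eI subrr; exact: idem_ideal0.
  by exists z; rewrite -zE scalerBl Ms // subr0.
exists n, (fun i => f (x i)); split.
  split=> [i|y|c].
  - by rewrite -linearZ xs.
  - have [z zE] := sL y; rewrite -[e s]eI -scalerA zE -linearZ.
    exact: fcomb.
  - have -> : \sum_i c i *: f (x i) = f (\sum_i c i *: x i).
      by rewrite linear_sum; apply: eq_bigr => i _; rewrite linearZ.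
    by move=> c0; apply: xfree; apply: fI; rewrite linear0.
move=> Q g gS g0.
(* With [Q'] the quotient of [L] by its trace, [Q] is an extension of the unchanged top factor by
   [Q']. *)
have [Q' [g' [gS' g0']]] := quot_mod_ex (combination0 x) (@combinationD _ _ x)
   (@combinationZ _ _ x).
have fQ' : filt Q' by apply: xQ g0'.
have [r rE] := choice gS'.
have gE y z : g' y = g' z -> g (f y) = g (f z).
  move=> yz; apply: subr0_eq; rewrite -!linearB; apply/g0/fcomb/g0'.
  by rewrite linearB yz subrr.
have [|h hE] := @linear_ex _ Q' Q (fun y => g (f (r y))).
  move=> a y z; rewrite -linearZ -linearD -linearZ -linearD; apply: gE.
  by rewrite linearD linearZ /= !rE.
have hgE y : h (g' y) = g (f y) by rewrite hE; apply: gE; rewrite rE.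
apply: (filt_step (f := h) (m := m) (v := g v)) => //.
- apply: linear_inj0 => y; have [z <-] := gS' y.
  by rewrite hgE => /g0/combf[t /fI ->]; move/g0'.
- move=> y; have [z <-] := gS y; have [a [t ->]] := vS z.
  by exists a, (g' t); rewrite hgE linearD linearZ.
- move=> a; rewrite -vU; split=> [[y]|[y yE]].
    have [z <-] := gS' y; rewrite hgE -linearZ => az.
    have /g0/combf[t tE _] : g (a *: v - f z) = 0 by rewrite linearB az subrr.
    by exists (t + z); rewrite linearD -tE subrK.
  by exists (g' y); rewrite hgE -yE linearZ.
Qed.

End StandardFiltrations.

(** * Removing one more idempotent *)

Section Truncation.
Variables (Lam : finType) (R : pzRingType) (e : Lam -> R) (le : rel Lam).
Hypothesis eI : forall l, e l * e l = e l.
Hypothesis le_total : forall l m, l != m -> ~~ le l m -> le m l.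

(** The quotient of [M] by the trace of [R e_s] does both: it remains filtered, and its annihilator
    grows exactly by the ideal of [e s]. This turns the projectives of one quotient algebra into
    those of the next. *)
Lemma filt_truncate s l (M : lmodType R) (v : M) :
  filt e le M -> cyclic_at e (above le s) l v ->
  exists (Q : lmodType R) (w : Q),
    filt e le Q /\ cyclic_at e (s |: above le s) l w.
Proof.
move=> fM vC; have Mk := cyclic_at_killed vC; have [vG vU] := vC.
have [n [x [[xs xspan _] xQ]]] := filt_trace eI le_total fM Mk.
have [Q [g [gS g0]]] := quot_mod_ex (combination0 x) (@combinationD _ _ _ x)
   (@combinationZ _ _ _ x).
exists Q, (g v); split; first exact: xQ g0.
split=> [y|a].
  by have [z <-] := gS y; have [a ->] := vG z; exists a; rewrite linearZ.
rewrite -linearZ g0; split=> [[c cE]|].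
  (* As [x i] is [b i *: v] and is fixed by [e s], the coefficient [a] differs from the sum of the
     [c i * e s * b i] by an annihilator of [v]. *)
  have [b bE] := choice (fun i => vG (x i)).
  have /vU aI : (a - \sum_i c i * e s * b i) *: v = 0.
    rewrite scalerBl cE scaler_suml; apply/eqP; rewrite subr_eq0; apply/eqP.
    by apply: eq_bigr => i _; rewrite -!scalerA -bE xs.
  rewrite -[a](subrK (\sum_i c i * e s * b i)) mulrDl; apply: idem_idealD.
    by apply: idem_idealS aI => u uU; rewrite !inE in uU *; rewrite uU orbT.
  apply/idem_idealMr/idem_ideal_sum => i; apply: idem_ideal_gen.
  by rewrite !inE eqxx.
move=> aI; have -> : a *: v = (a * e l) *: v.
  by rewrite -scalerA (cyclic_at_idem eI vC).
elim: aI => [|y z _ IHy _ IHz|u b c uU].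
- by rewrite scale0r; apply: combination0.
- by rewrite scalerDl; apply: combinationD.
- rewrite -!scalerA; apply: combinationZ.
  case/setU1P: uU => [->|uU]; first exact: xspan.
  by rewrite Mk //; apply: combination0.
Qed.

End Truncation.

(** * Idempotents with local corner rings *)

Section LocalIdempotents.

(** Locality of the corner ring [f R f] in its finite-dimensional form: every element is nilpotent
    or invertible, with unit element [f]. *)
Definition local_idem (R : pzRingType) (f : R) : Prop :=
  forall x : R, f * x * f = x ->
    (exists n, x ^+ n = 0) \/
    (exists y : R, [/\ f * y * f = y, x * y = f & y * x = f]).

Lemma Pmod_ex (Lam : finType) (R : pzRingType) (e : Lam -> R) l :
  e l * e l = e l ->
  exists j : {linear Pmod e l -> R^o},
    injective j /\ forall x : R, x * e l = x <-> exists y, j y = x.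
Proof.
move=> eI; have [j [jI jE]] := submod_of_ex (left_ideal (e l)).
exists j; split=> // x; rewrite -jE; split=> [<-|/asboolP[a ->]].
  by apply/asboolP; exists x.
by rewrite -mulrA eI.
Qed.

Lemma Pmod_cyclic_at (Lam : finType) (R : pzRingType) (e : Lam -> R) l :
  e l * e l = e l -> exists v : Pmod e l, cyclic_at e set0 l v.
Proof.
move=> eI; have [j [jI jE]] := Pmod_ex eI; have [v vE] := (jE (e l)).1 eI.
exists v; split=> [x|a].
  exists (j x : R); apply: jI; rewrite linearZ /= vE.
  by apply/esym/jE; exists x.
split=> [/(congr1 j)|/idem_ideal_set0 a0].
  by rewrite linearZ linear0 /= vE => ae; rewrite [_ * _]ae; apply: idem_ideal0.
by apply: jI; rewrite linearZ linear0 /= vE.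
Qed.

Variables (Lam : finType) (R : pzRingType) (e : Lam -> R).
Hypothesis eI : forall l, e l * e l = e l.
Hypothesis eL : forall l, local_idem (e l).

(* Modulo [K], both [v] and [n] generate the same nonzero cyclic module, of tops
   [S_m] and [S_s]; locality turns [b] and [c] into isomorphisms between
   [R e_m] and [R e_s]. *)
Lemma local_top_iso (T : lmodType R) (K : submodClosed T) m s (n v : T) b c :
  e s *: n = n -> e m *: v - v \in K -> v - b *: n \in K -> n - c *: v \in K ->
  v \notin K ->
  mod_iso (Pmod e m) (Pmod e s) /\ exists w : R, e s * c * e m * w = e s.
Proof.
move=> en ev vb nc vK.
have KN (x : T) : x \in K -> - x \in K by move=> xK; rewrite -scaleN1r rpredZ.
have KB (x y : T) : x \in K -> y \in K -> x - y \in K.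
  by move=> xK yK; rewrite rpredD // KN.
(* These are [b] and [c] cut down to the corners. Their product [z] fixes [v] modulo [K], so none of
   its powers vanishes. *)
pose x := e m * b * e s; pose y := e s * c * e m; pose z := x * y.
have xs : x * e s = x by rewrite /x -mulrA eI.
have mx : e m * x = x by rewrite /x !mulrA eI.
have sy : e s * y = y by rewrite /y !mulrA eI.
have ym : y * e m = y by rewrite /y -mulrA eI.
have zv : z *: v - v \in K.
  have -> : z *: v - v = x *: (y *: v - n) + (x *: n - v).
    by rewrite scalerBr scalerA addrA subrK.
  rewrite rpredD //.
    rewrite rpredZ // /y -scalerA -(scalerA (e s)) -en -scalerBr rpredZ //.
    have -> : c *: (e m *: v) - n = c *: (e m *: v - v) - (n - c *: v).
      by rewrite scalerBr opprB addrA subrK.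
    by rewrite KB // rpredZ.
  rewrite /x -!scalerA en.
  have -> : e m *: (b *: n) - v = (e m *: v - v) - e m *: (v - b *: n).
    by rewrite scalerBr opprB [RHS]addrC addrA subrK.
  by rewrite KB // rpredZ.
have znv i : z ^+ i *: v - v \in K.
  elim: i => [|i IH]; first by rewrite expr0 scale1r subrr rpred0.
  have -> : z ^+ i.+1 *: v - v = z *: (z ^+ i *: v - v) + (z *: v - v).
    by rewrite scalerBr scalerA -exprS addrA subrK.
  by rewrite rpredD // rpredZ.
have znil i : z ^+ i <> 0.
  move=> zi; have := znv i; rewrite zi scale0r sub0r => /KN.
  by rewrite opprK (negPf vK).
have zm : e m * z * e m = z by rewrite /z mulrA mx -mulrA ym.
have yxs : e s * (y * x) * e s = y * x by rewrite mulrA sy -mulrA xs.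
have [[i zi]|[u [um zu uz]]] := eL zm; first by case: (znil i).
(* If [y * x] were nilpotent, so would be [z], because [z ^+ i.+1 = x * (y * x) ^+ i * y]. *)
have [[i zi]|[u' [us zu' uz']]] := eL yxs.
  case: (znil i.+1); suff -> : z ^+ i.+1 = x * (y * x) ^+ i * y.
    by rewrite zi mulr0 mul0r.
  elim: (i) => [|h IH]; first by rewrite expr0 mulr1.
  by rewrite exprSr IH exprSr /z !mulrA.
split; last by exists (x * u'); rewrite -/y mulrA.
(* The isomorphism is right multiplication by [x]: onto because [y * x] is invertible, injective
   because [x * y] is. *)
have [p [pG p0]] := Pmod_cyclic_at (eI m).
have [j [jI jE]] := Pmod_ex (eI s).
have [q qE] := (jE x).1 xs.
apply: (cyclic_mod_iso (u := p) (v := q)) => //.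
  move=> t; exists ((j t : R) * u' * y); apply: jI; rewrite linearZ /= qE.
  rewrite [RHS](_ : _ = (j t : R) * u' * y * x) //.
  rewrite -(mulrA _ y x) -(mulrA _ u') uz'.
  by apply/esym/jE; exists t.
move=> a; rewrite p0.
have -> : a *: q = 0 <-> a * x = 0.
  by split=> [/(congr1 j)|ax]; [|apply: jI]; rewrite linearZ linear0 /= qE.
split=> [/idem_ideal_set0 ae|ax]; first by rewrite -mx mulrA ae mul0r.
by rewrite -zu /z 2!(mulrA a) ax !mul0r; apply: idem_ideal0.
Qed.

End LocalIdempotents.

(** * Primitive idempotents of a finite-dimensional algebra are local *)

Section FiniteDimensional.
Variables (k : fieldType) (A : falgType k).

Lemma algebraic_falg (x : A) : exists2 p : {poly k}, p != 0 & horner_alg x p = 0.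
Proof.
pose n := (\dim {:A}).+1; pose X := [tuple x ^+ (i : 'I_n) | i < n].
have /freeP : ~~ free X.
  by rewrite /free size_tuple neq_ltn ltnS dimvS ?subvf.
move=> nfree.
have [c [cX [i ci]]] : exists c : 'I_n -> k,
    \sum_(i < n) c i *: X`_i = 0 /\ exists i, c i <> 0.
  apply: contrapT => nex; apply: nfree => c cX i; apply: contrapT => ci.
  by apply: nex; exists c; split=> //; exists i.
exists (\poly_(i < n) (if insub i is Some j then c j else 0)).
  apply: contra_not_neq ci => /(congr1 (fun p : {poly k} => p`_i)).
  by rewrite coef_poly coef0 ltn_ord valK.
have XE (j : 'I_n) : X`_j = x ^+ j.
  by rewrite -(tnth_nth 0 X) tnth_mktuple.
rewrite -cX poly_def linear_sum; apply: eq_bigr => j _.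
by rewrite linearZ /= valK rmorphXn /= horner_algX XE mulr_algl.
Qed.

(** Split an annihilating polynomial of [x] into a power of X and a factor [q] prime to X. Bezout
    then writes [f] as a sum of two orthogonal idempotents [g1] and [g2], one of which is zero by
    primitivity: [x] is nilpotent if [g1] is, invertible if [g2] is. *)
Lemma primitive_local (f : A) : primitive_idem f -> local_idem f.
Proof.
case=> fI f0 fP x fxf.
have fx : f * x = x by rewrite -fxf !mulrA fI.
have xf : x * f = x by rewrite -fxf -!mulrA fI.
have [p p0 px] := algebraic_falg x.
have [m [q qroot pE]] := multiplicity_XsubC p 0.
rewrite p0 /= in qroot; rewrite subr0 in pE.
(* The exponent [m.+1] in place of [m] leaves a factor X to divide out when the inverse is formed,
   even for [m = 0]. *)
have /Bezout_coprimepP[[u w] /= uw] : coprimep ('X ^+ m.+1) q.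
  by rewrite coprimep_expl // coprimep_sym -['X]subr0 -polyC0 coprimep_XsubC.
have [a a0 uwE] : exists2 a : k, a != 0 & u * 'X ^+ m.+1 + w * q = a%:P.
  move: uw; rewrite -size_poly_eq1 => /eqP/eqP/size_poly1P[a a0 ->].
  by exists a.
pose h : {poly k} -> A := horner_alg x.
have hD b c : h (b + c) = h b + h c by apply: rmorphD.
have hM b c : h (b * c) = h b * h c by apply: rmorphM.
have hZ b c : h (b *: c) = b *: h c by rewrite /h linearZ /= mulr_algl.
have hXn i : h 'X^i = x ^+ i by rewrite /h rmorphXn /= horner_algX.
have hp : h p = 0 by [].
have h0 : h 0 = 0 by apply: rmorph0.
have h1 : h 1 = 1 by apply: rmorph1.
have hC b : f * h b = h b * f.
  elim/poly_ind: b => [|b c IH]; first by rewrite h0 mulr0 mul0r.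
  rewrite hD hM -['X]expr1 hXn expr1 -alg_polyC hZ h1 mulrDr mulrDl.
  by rewrite mulrA IH -!mulrA fx xf -scalerAl -scalerAr mul1r mulr1.
clearbody h.
have qX : h (q * 'X^(m.+1)) = 0.
  by rewrite exprSr mulrA -pE hM hp mul0r.
pose g1 := f * h (a^-1 *: (u * 'X^(m.+1))); pose g2 := f * h (a^-1 *: (w * q)).
have g12 : f = g1 + g2.
  rewrite /g1 /g2 -mulrDr -hD -scalerDr uwE -mul_polyC -polyCM mulVf //.
  by rewrite h1 mulr1.
have fhfh b c : f * h b * (f * h c) = f * h (b * c).
  by rewrite mulrA -(mulrA f) -hC mulrA fI -mulrA -hM.
have g12_0 : g1 * g2 = 0.
  rewrite fhfh -scalerAl -scalerAr mulrACA [_ * q]mulrC !hZ hM qX.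
  by rewrite mulr0 !scaler0 mulr0.
have g21_0 : g2 * g1 = 0 by rewrite fhfh mulrC -fhfh.
have fg1 : f * g1 = g1 by rewrite /g1 mulrA fI.
have fg2 : f * g2 = g2 by rewrite /g2 mulrA fI.
have g1g1 : g1 * g1 = g1 by rewrite -[RHS]fg1 g12 mulrDl g21_0 addr0.
have g2g2 : g2 * g2 = g2 by rewrite -[RHS]fg2 g12 mulrDl g12_0 add0r.
have [g10|g20] := fP g1 g2 g1g1 g2g2 g12_0 g21_0 g12.
  left; exists m.+1; rewrite -hXn.
  have -> : h 'X^(m.+1) = f * h 'X^(m.+1) by rewrite hXn exprS mulrA fx.
  rewrite hC g12 g10 add0r /g2 hC mulrA -hM -scalerAr mulrCA hZ hM.
  by rewrite [_ * q]mulrC qX mulr0 scaler0 mul0r.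
right; pose y := f * h (a^-1 *: (u * 'X^m)).
have fE : f = f * h (a^-1 *: (u * 'X^(m.+1))) by rewrite {1}g12 g20 addr0.
have hX : h 'X = x by rewrite -['X]expr1 hXn expr1.
exists y; split.
- by rewrite /y mulrA fI -mulrA -hC mulrA fI.
- rewrite /y mulrA xf [RHS]fE -{1}fx -hX -mulrA -hM.
  by congr (_ * h _); rewrite -scalerAr mulrCA -exprS.
- rewrite /y [RHS]fE -hX -mulrA -hM.
  by congr (_ * h _); rewrite -scalerAl -mulrA -exprSr.
Qed.

(** A subspace of maximal dimension inside [P] is all of [P], since a missing vector would enlarge
    it. *)
Lemma vspace_ex (vT : vectType k) (P : vT -> Prop) :
  P 0 -> (forall x y, P x -> P y -> P (x + y)) ->
  (forall a x, P x -> P (a *: x)) ->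
  exists W : {vspace vT}, forall x, x \in W <-> P x.
Proof.
move=> P0 PD PZ.
pose d n := `[< exists2 W : {vspace vT}, \dim W = n & forall x, x \in W -> P x >].
have d0 : exists n, d n.
  exists 0%N; apply/asboolP; exists 0%VS; first exact: dimv0.
  by move=> x; rewrite memv0 => /eqP ->.
have dub n : d n -> (n <= \dim {:vT})%N.
  by move=> /asboolP[W <- _]; rewrite dimvS ?subvf.
case: (ex_maxnP d0 dub) => n /asboolP[W dW WP] nmax.
exists W => x; split=> [/WP|Px] //.
have : d (\dim (W + <[x]>)).
  apply/asboolP; exists (W + <[x]>)%VS => // y.
  move=> /memv_addP[w wW [z /vlineP[c ->] ->]].
  by apply: PD; [apply: WP|apply: PZ].
move=> /nmax; rewrite -dW => dle.
have /eqP -> : W == (W + <[x]>)%VS by rewrite eqEdim addvSl dle.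
by rewrite (subvP (addvSr W <[x]>)) // memv_line.
Qed.

End FiniteDimensional.

(** * Composition series of cyclic modules *)

Section CompositionSeries.

Lemma simple_subquot (R : pzRingType) (M : lmodType R) (N' N : submodClosed M) :
  {subset N' <= N} -> (exists2 x, x \in N & x \notin N') ->
  (forall H : submodClosed M, {subset N' <= H} -> {subset H <= N} ->
    {subset H <= N'} \/ {subset N <= H}) ->
  simple_mod (subquot N' N).
Proof.
move=> N'N [x xN xN'] Hmax; have [L [j [q [jN qS q0]]]] := subquot_ex N' N.
move: (subquot N' N) q qS q0 => Q q qS q0; split.
  have [y yE] := (jN x).1 xN; exists (q y); apply: contraNneq xN' => /q0.
  by rewrite yE.
move=> G.
(* [P] is the preimage of [G] between [N'] and [N]; it asks for every [z] over [y], and [jq] shows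
   that the choice does not matter. *)
pose P y := y \in N /\ forall z, j z = y -> q z \in G.
have jq z t : j z = j t -> q z = q t.
  move=> zt; apply: subr0_eq; rewrite -linearB; apply/q0.
  by rewrite linearB zt subrr rpred0.
have [|y t|a y|H HP] := @submod_ex _ M P.
- by split=> [|z z0]; [exact: rpred0|rewrite (jq z 0) ?linear0 ?rpred0].
- move=> [yN yG] [tN tG]; split=> [|z zE]; first exact: rpredD.
  have [y' yE] := (jN y).1 yN; have [t' tE] := (jN t).1 tN.
  rewrite (jq z (y' + t')); last by rewrite zE linearD /= yE tE.
  by rewrite linearD; apply: rpredD; [apply: yG|apply: tG].
- move=> [yN yG]; split=> [|z zE]; first exact: rpredZ.
  have [y' yE] := (jN y).1 yN.
  rewrite (jq z (a *: y')); last by rewrite zE linearZ /= yE.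
  by rewrite linearZ; apply: rpredZ; apply: yG.
have N'H : {subset N' <= H}.
  move=> y yN'; apply/HP; split=> [|z zE]; first exact: N'N.
  by have /q0 -> : j z \in N'; [rewrite zE|exact: rpred0].
have HN : {subset H <= N} by move=> y /HP[].
have [HN'|NH] := Hmax H N'H HN.
  left=> y yG; have [z zE] := qS y; rewrite -zE; apply/q0/HN'/HP.
  split=> [|t tE]; first by apply/jN; exists z.
  by rewrite (jq _ _ tE) zE.
right=> y; have [z <-] := qS y.
have /NH/HP[_] : j z \in N by apply/jN; exists z.
exact.
Qed.

(** [M] carries no vector space structure over [k], so a submodule [G] is measured by the dimension
    of its preimage [W G] under [a |-> a *: v]. A proper submodule of maximal measure gives a simple
    factor. *)
Lemma composition_series_ex (k : fieldType) (A : falgType k)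
    (M : lmodType A) (v : M) :
  generates v ->
  exists (n : nat) (F : nat -> submodClosed M), is_filtration n F /\
    forall i, (i < n)%N -> simple_mod (subquot (F i) (F i.+1)).
Proof.
move=> vG.
have Wex (G : submodClosed M) :
    exists W : {vspace A}, forall a, a \in W <-> a *: v \in G.
  apply: vspace_ex => [|x y xG yG|a x xG].
  - by rewrite scale0r rpred0.
  - by rewrite scalerDl rpredD.
  - by rewrite -mulr_algl -scalerA rpredZ.
have [W WE] := choice Wex.
have WS (G H : submodClosed M) : {subset G <= H} -> (W G <= W H)%VS.
  by move=> GH; apply/subvP => a /WE aG; apply/WE/GH.
have Weq (G H : submodClosed M) :
    {subset G <= H} -> (\dim (W H) <= \dim (W G))%N -> {subset H <= G}.
  move=> GH dHG x; have [a ->] := vG x; move/WE.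
  have /eqP <- : W G == W H by rewrite eqEdim WS.
  by move/WE.
suff: forall d (G : submodClosed M), (\dim (W G) <= d)%N ->
    exists n (F : nat -> submodClosed M),
    [/\ forall x, x \in F 0%N -> x = 0, F n = G,
       forall i, (i < n)%N -> {subset F i <= F i.+1}
     & forall i, (i < n)%N -> simple_mod (subquot (F i) (F i.+1))].
  have [T TP] : exists T : submodClosed M, forall x, x \in T <-> True.
    exact: submod_ex.
  move=> /(_ _ T (leqnn _))[n [F [F0 FT FS Fsimple]]].
  by exists n, F; split=> //; split=> // x; rewrite FT; apply/TP.
elim=> [|d IH] G dG.
  exists 0%N, (fun=> G); split=> // x; have [a ->] := vG x => /WE.
  rewrite (_ : W G = 0%VS) ?memv0; last by apply/eqP; rewrite -dimv_eq0 -leqn0.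
  by move/eqP->; rewrite scale0r.
have [G0|Gn0] := pselect (forall x, x \in G -> x = 0).
  by exists 0%N, (fun=> G).
pose D n := `[< exists2 H : submodClosed M, \dim (W H) = n &
               {subset H <= G} /\ ~ {subset G <= H} >].
have [Z ZP] : exists Z : submodClosed M, forall x, x \in Z <-> x = 0.
  apply: submod_ex => // [x y -> ->|a x ->]; first exact: addr0.
  exact: scaler0.
have D0 : exists n, D n.
  exists (\dim (W Z)); apply/asboolP; exists Z => //; split.
    by move=> x /ZP ->; apply: rpred0.
  by move=> GZ; apply: Gn0 => x /GZ /ZP.
have Dub n : D n -> (n <= \dim (W G))%N.
  by move=> /asboolP[H <- [HG _]]; apply: dimvS; apply: WS.
case: (ex_maxnP D0 Dub) => n /asboolP[H dH [HG GH]] nmax.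
have dHG : (\dim (W H) < \dim (W G))%N.
  by rewrite ltnNge; apply/negP => /(Weq _ _ HG).
have [|m [F [F0 FH FS Fsimple]]] := IH H.
  by rewrite -ltnS (leq_trans dHG).
exists m.+1, (fun i => if (i <= m)%N then F i else G); split=> //.
- by rewrite ltnn.
- move=> i; rewrite ltnS => im; rewrite im.
  by case: ltngtP im => // [im|->] _; [apply: FS|rewrite FH].
- move=> i; rewrite ltnS => im; rewrite im.
  case: ltngtP im => // [im|->] _; first exact: Fsimple.
  rewrite FH; apply: simple_subquot => //.
    apply: contrapT => nex; apply: GH => x xG; apply: contrapT => xH.
    by apply: nex; exists x => //; apply/negP.
  move=> H' HH' H'G; have [GH'|GH'] := pselect {subset G <= H'}; first by right.
  left; apply: Weq => //; rewrite dH; apply: nmax.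
  by apply/asboolP; exists H'.
Qed.

End CompositionSeries.

(** * Standard modules as cyclic modules *)

Section StandardModules.
Variables (Lam : finType) (k : fieldType) (A : falgType k) (e : Lam -> A).
Variable le : rel Lam.
Hypothesis eI : forall l, e l * e l = e l.
Hypothesis eL : forall l, local_idem (e l).
Hypothesis hle : linear_order le.
Implicit Types (L M N Q : lmodType A).

Lemma Smod_generator m : exists w : Smod e m, generates w /\ e m *: w = w.
Proof.
have [p pC] := Pmod_cyclic_at (eI m); have [pG _] := pC.
have [g [gS _]] := quot_map_ex (rad (Pmod e m)).
exists (g p); split; last by rewrite -linearZ (cyclic_at_idem eI pC).
move=> y; have [x <-] := gS y; have [a ->] := pG x.
by exists a; rewrite -linearZ.
Qed.

(** The map from [P_m] sending its generator to [w] is onto, and its kernel is the radical: by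
    locality of [e m] it is the only maximal submodule. *)
Lemma simple_Smod_iso (S : lmodType A) m (w : S) :
  simple_mod S -> w <> 0 -> e m *: w = w -> mod_iso S (Smod e m).
Proof.
move=> [_ Smax] w0 ew.
have gen (x : S) : x <> 0 -> generates x.
  move=> x0; have [|y z [a ->] [b ->]|b y [a ->]|H HP] :=
    @submod_ex _ S (fun y => exists a : A, y = a *: x).
  - by exists 0; rewrite scale0r.
  - by exists (a + b); rewrite scalerDl.
  - by exists (b * a); rewrite scalerA.
  have [H0|HT] := Smax H; last by move=> y; apply/HP.
  by case: x0; apply: H0; apply/HP; exists 1; rewrite scale1r.
have [p pC] := Pmod_cyclic_at (eI m); have [pG p0] := pC.
have ep := cyclic_at_idem eI pC.
have [|h hE] := cyclic_linear (v := w) pG.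
  by move=> a /p0/idem_ideal_set0 ae; rewrite -ew scalerA ae scale0r.
have hp : h p = w by rewrite -[p]scale1r hE scale1r.
have [|x y hx hy|a x hx|K KP] := @submod_ex _ (Pmod e m) (fun x => h x = 0).
- exact: linear0.
- by rewrite linearD hx hy addr0.
- by rewrite linearZ /= hx scaler0.
have radP x : x \in rad (Pmod e m) <-> h x = 0.
  split=> [/asboolP radx|hx]; [apply/KP/radx|apply/asboolP => N' [[t tN'] N'max]].
    split; first by exists p; apply/negP => /KP; rewrite hp.
    move=> N' KN'; have [N'K|N'K] := pselect {subset N' <= K}; first by left.
    right=> y; have [z [zN' zK]] : exists z, z \in N' /\ h z <> 0.
      apply: contrapT => nex; apply: N'K => z zN'.
      apply/KP; apply: contrapT => hz.
      by apply: nex; exists z.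
    have [b wE] := gen _ zK w.
    have pN' : p \in N'.
      rewrite -[p](subrK (b *: z)) rpredD //; last exact: rpredZ.
      by apply/KN'/KP; rewrite linearB linearZ /= hp wE subrr.
    by have [a ->] := pG y; apply: rpredZ.
  apply: contrapT => xN'.
  have [|y z [c cy] [d dz]|c y [d dy]|H HP] :=
    @submod_ex _ (Pmod e m) (fun y => exists c : A, y - c *: x \in N').
  - by exists 0; rewrite scale0r subr0 rpred0.
  - exists (c + d); rewrite scalerDl opprD addrACA; exact: rpredD.
  - by exists (c * d); rewrite -scalerA -scalerBr; apply: rpredZ.
  have [|HN'|HT] := N'max H.
  - by move=> y yN'; apply/HP; exists 0; rewrite scale0r subr0.
  - case: xN'; apply: HN'; apply/HP; exists 1.
    by rewrite scale1r subrr rpred0.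
  have /HP[c cN'] := HT p; have [d dE] := pG x.
  (* This corner element kills [w] but fixes the generator [p] modulo [N'], hence is neither
     invertible nor nilpotent. *)
  pose z := e m * (c * d) * e m.
  have zw : z *: w = 0.
    by rewrite /z -!scalerA ew -hE -dE hx !scaler0.
  have zp : z *: p - p \in N'.
    have -> : z *: p - p = (- e m) *: (p - c *: x).
      by rewrite /z -!scalerA ep -dE scalerBr !scaleNr opprK ep addrC.
    exact: rpredZ.
  have zpn i : z ^+ i *: p - p \in N'.
    elim: i => [|i IH]; first by rewrite expr0 scale1r subrr rpred0.
    have -> : z ^+ i.+1 *: p - p = z *: (z ^+ i *: p - p) + (z *: p - p).
      by rewrite scalerBr scalerA -exprS addrA subrK.
    by rewrite rpredD // rpredZ.
  have ze : e m * z * e m = z by rewrite /z !mulrA eI -!mulrA eI.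
  have [[n zn]|[u [_ _ uz]]] := eL ze.
    have := zpn n; rewrite zn scale0r sub0r => /(rpredZ (-1)).
    rewrite scaleN1r opprK => pN'; case/negP: tN'.
    by have [b ->] := pG t; apply: rpredZ.
  by case: w0; rewrite -ew -uz -scalerA zw scaler0.
have [g [gS g0]] := quot_map_ex (rad (Pmod e m)).
apply: (cyclic_mod_iso (u := w) (v := g p)); first exact: gen.
  move=> y; have [x <-] := gS y; have [a ->] := pG x.
  by exists a; rewrite -linearZ.
by move=> a; rewrite -linearZ g0 radP hE.
Qed.

Lemma composition_factor_killed m M :
  (forall x : M, e m *: x = 0) -> ~ composition_factor M (Smod e m).
Proof.
move=> Mk [n [F [_ Fsimple [i lin FiS]]]].
have [w [wG ew]] := Smod_generator m.
have := Fsimple i lin; have [h [h' hK h'K]] := mod_iso_sym FiS.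
have [L [j [q [jN qS q0]]]] := subquot_ex (F i) (F i.+1).
move: (subquot _ _) q qS q0 h h' hK h'K => T q qS q0 h h' hK h'K.
case=> -[x x0] _; case/eqP: x0.
have [y yE] := qS (h w).
have hw : h w = 0.
  by rewrite -ew linearZ /= -yE -linearZ; apply/q0; rewrite linearZ /= Mk rpred0.
have [b bE] := wG (h' x).
by rewrite -[x]h'K bE linearZ /= hw scaler0.
Qed.

(** At the step of a composition series where [t] first appears, the simple factor has a nonzero
    vector fixed by [e m], hence is S_m. *)
Lemma composition_factor_ex m M (v t : M) :
  generates v -> t <> 0 -> e m *: t = t -> composition_factor M (Smod e m).
Proof.
move=> vG t0 et.
have [n [F [[F0 Fn FS] Fsimple]]] := composition_series_ex vG.
have exF : exists i, t \in F i by exists n.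
case: (ex_minnP exF) => -[/F0 //|i] tF imin.
have tFi : t \notin F i by apply/negP => /imin; rewrite ltnn.
have lin : (i < n)%N by apply: imin; apply: Fn.
exists n, F; split=> //; exists i => //.
have := Fsimple i lin.
have [L [j [q [jN qS q0]]]] := subquot_ex (F i) (F i.+1).
move: (subquot _ _) q qS q0 => T q qS q0 Tsimple.
have [y yE] := (jN t).1 tF.
apply: (simple_Smod_iso (w := q y)) => //.
  by move=> /q0; rewrite yE; apply/negP.
apply: subr0_eq; rewrite -linearZ -linearB; apply/q0.
by rewrite linearB linearZ /= yE et subrr rpred0.
Qed.

Lemma aboveP l m : m \in above le l <-> ~~ le m l.
Proof.
case: hle => rf anti _ tot; rewrite inE; split=> [/andP[lm ml]|ml].
  by apply: contraNN ml => ml; apply/eqP/anti/andP.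
have := tot m l; rewrite (negPf ml) /= => ->.
by apply: contraNneq ml => ->; apply: rf.
Qed.

(** S_m is a composition factor of a cyclic module exactly when [e m] does not kill it. So the
    admissible quotients of [P_l] are those killed by all [e m] with [m] above [l]. *)
Lemma std_kernelP l (p : Pmod e l) (a : A) : cyclic_at e set0 l p ->
  a *: p \in std_kernel e le l <-> idem_ideal e (above le l) (a * e l).
Proof.
move=> pC; have [pG p0] := pC; have ep := cyclic_at_idem eI pC.
split=> [/asboolP aK|aI].
  have [|x y [b bE bI] [c cE cI]|c x [b bE bI]|N NP] := @submod_ex _ (Pmod e l)
      (fun x => exists2 b : A, x = b *: p & idem_ideal e (above le l) (b * e l)).
  - by exists 0; rewrite ?scale0r // mul0r; apply: idem_ideal0.
  - exists (b + c); first by rewrite bE cE scalerDl.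
    by rewrite mulrDl; apply: idem_idealD.
  - exists (c * b); first by rewrite bE scalerA.
    by rewrite -mulrA; apply: idem_idealMl.
  have /NP[b abE bI] : a *: p \in N.
    apply: aK => m; apply: contraPT => /aboveP ml.
    apply: composition_factor_killed.
    have [g [gS g0]] := quot_map_ex N; move: (quot_mod N) g gS g0 => Q g gS g0 x.
    have [y <-] := gS x; rewrite -linearZ; apply/g0/NP.
    have [c ->] := pG y; exists (e m * c); first by rewrite scalerA.
    by rewrite -[e m]mul1r -mulrA; apply: idem_ideal_gen.
  have /p0/idem_ideal_set0 : (a - b) *: p = 0 by rewrite scalerBl abE subrr.
  by rewrite mulrBl => /subr0_eq ->.
apply/asboolP => N Nadm; rewrite -ep scalerA.
elim: aI => [|x y _ xN _ yN|m b c lm]; first by rewrite scale0r rpred0.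
  by rewrite scalerDl rpredD.
rewrite -!scalerA; apply: rpredZ.
apply: contraT => mN; case/negP: ((aboveP l m).1 lm); apply: Nadm.
have [g [gS g0]] := quot_map_ex N; move: (quot_mod N) g gS g0 => Q g gS g0.
apply: (composition_factor_ex (v := g p) (t := g (e m *: (c *: p)))).
- move=> y; have [x <-] := gS y; have [d ->] := pG x.
  by exists d; rewrite -linearZ.
- by move=> /g0; apply/negP.
- by rewrite -linearZ scalerA eI.
Qed.

Lemma standard_cyclic l :
  exists v : standard e le l, cyclic_at e (above le l) l v.
Proof.
have [p pC] := Pmod_cyclic_at (eI l).
have [g [gS g0]] := quot_map_ex (std_kernel e le l).
rewrite /standard; move: (quot_mod _) g gS g0 => Q g gS g0.
exists (g p); split=> [y|a].
  have [x <-] := gS y; have [a ->] := pC.1 x.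
  by exists a; rewrite -linearZ.
by rewrite -linearZ g0 std_kernelP.
Qed.

Lemma std_filtered_filt B M : std_filtered e le B M -> filt e le M.
Proof.
move=> [n [F [[F0 Fn FS] Fstd]]].
(* Allowing any [L] embedded onto [F i] makes the induction end at [M] itself instead of the subtype
   of [F n]. *)
suff chain i : (i <= n)%N -> forall L (j : {linear L -> M}), injective j ->
    (forall x, x \in F i <-> exists y, j y = x) -> filt e le L.
  apply: (chain n (leqnn n) M [the {linear M -> M} of idfun]) => // x.
  by split=> [_|_]; [exists x|apply: Fn].
elim: i => [|i IH] lin L j jI jF.
  apply: filt_zero => x; apply: jI; rewrite linear0; apply: F0.
  by apply/jF; exists x.
have [L' [j' [j'I j'F]]] : exists (L' : lmodType A) (j' : {linear L' -> M}),
    injective j' /\ forall x, x \in F i <-> exists y, j' y = x.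
  by exists (submod_of (F i)); apply: submod_of_ex.
have fL' : filt e le L' by apply: (IH (ltnW lin)) j'F.
have j'L y : exists z, j z = j' y.
  by apply/jF; apply: (FS i lin); apply/j'F; exists y.
have [f0 f0E] := choice j'L.
have [|f fE] := @linear_ex _ L' L f0.
  by move=> a x y; apply: jI; rewrite linearP !f0E linearP.
have jf y : j (f y) = j' y by rewrite fE.
have [m _ mI] := Fstd i lin; have [u [uG uC]] := standard_cyclic m.
have [w [/jF[v vE] wG wI]] := (subquot_mod_isoP (F i) (F i.+1) uG uC).1 mI.
apply: (filt_step (f := f) (m := m) (v := v)) => //.
- by move=> x y xy; apply: j'I; rewrite -!jf xy.
- move=> x; have [|a /j'F[y yE]] := wG (j x); first by apply/jF; exists x.
  exists a, y; apply: jI; rewrite linearD linearZ /= jf yE vE.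
  by rewrite addrC subrK.
- move=> a; rewrite -wI; split=> [[y yE]|/j'F[y yE]].
    by apply/j'F; exists y; rewrite -jf -yE linearZ /= vE.
  by exists y; apply: jI; rewrite linearZ /= vE jf.
Qed.

Lemma filt_std_filtered M : filt e le M -> std_filtered e le predT M.
Proof.
elim=> {M} [M M0|L M f m v fI _ [n [F [[F0 Fn FS] Fstd]]] vS vU].
  have [Z ZP] : exists Z : submodClosed M, forall x, x \in Z <-> True.
    exact: submod_ex.
  by exists 0%N, (fun=> Z); split=> //; split=> // x; apply/ZP.
(* [H i] is the image of [F i] for [i <= n]; beyond [n] the condition is vacuous and [H i] is all of
   [M]. *)
have Hex i : exists H : submodClosed M, forall x,
    x \in H <-> ((i <= n)%N -> exists2 y, y \in F i & f y = x).
  apply: submod_ex.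
  - by move=> _; exists 0; [apply: rpred0|apply: linear0].
  - move=> x y hx hy lin; have [x' x'F <-] := hx lin; have [y' y'F <-] := hy lin.
    by exists (x' + y'); [apply: rpredD|apply: linearD].
  - move=> a x hx lin; have [x' x'F <-] := hx lin.
    by exists (a *: x'); [apply: rpredZ|apply: linearZ].
have [H HP] := choice Hex.
have HfP i y : (i <= n)%N -> f y \in H i <-> y \in F i.
  move=> lin; rewrite HP; split=> [/(_ lin)[z zF /fI <-] //|yF _].
  by exists y.
have Hf i x : (i <= n)%N -> x \in H i -> exists2 y, y \in F i & f y = x.
  by move=> lin /HP; apply.
exists n.+1, H; split.
  split=> [x /(Hf _ _ (leq0n n))[y /F0 -> <-]|x|i].
  - exact: linear0.
  - by apply/HP; rewrite ltnn.
  - rewrite ltnS => lin x /(Hf _ _ lin)[y yF <-].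
    by apply/HP => lin'; exists y => //; apply: FS.
move=> i; rewrite ltnS leq_eqVlt => /orP[/eqP ->|lin].
  exists m => //; have [u [uG uC]] := standard_cyclic m.
  apply/(subquot_mod_isoP _ _ uG uC); exists v; split.
  - by apply/HP; rewrite ltnn.
  - move=> x _; have [a [y ->]] := vS x; exists a.
    by rewrite addrC addKr; apply/HfP.
  - move=> a; rewrite -vU; split=> [/(Hf _ _ (leqnn n))[y _ <-]|[y ->]].
      by exists y.
    by apply/HfP.
have [m' _ mI] := Fstd i lin; exists m' => //.
have [u [uG uC]] := standard_cyclic m'.
have [w [wF wG wI]] := (subquot_mod_isoP (F i) (F i.+1) uG uC).1 mI.
apply/(subquot_mod_isoP _ _ uG uC); exists (f w); split.
- by apply/HfP.
- move=> x /(Hf _ _ lin)[y /wG[a aF] <-]; exists a.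
  by rewrite -linearZ -linearB; apply/HfP => //; apply: ltnW.
- by move=> a; rewrite -linearZ HfP ?wI // ltnW.
Qed.

End StandardModules.

(** * Free traces *)

Section Traces.
Variables (Lam : finType) (R : pzRingType) (e : Lam -> R) (s : Lam).
Hypothesis eI : forall l, e l * e l = e l.

(** Maps out of [P_s] correspond to elements fixed by [e s], so the trace is the span of the [x i];
    coefficients can be taken in [R e_s], where they are unique. *)
Lemma trace_basis_iso (N : lmodType R) n (x : 'I_n -> N) :
  (forall i, e s *: x i = x i) -> (forall y, combination x (e s *: y)) ->
  (forall c : 'I_n -> R, \sum_i c i *: x i = 0 -> forall i, c i * e s = 0) ->
  mod_iso (submod_of (trace (Pmod e s) N)) {ffun 'I_n -> Pmod e s}.
Proof.
move=> xs xspan xfree.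
have [p pC] := Pmod_cyclic_at (eI s); have [pG p0] := pC.
have ep := cyclic_at_idem eI pC.
have [j [jI jE]] := Pmod_ex (eI s).
have traceP y : y \in trace (Pmod e s) N <-> combination x y.
  split=> [/asboolP[m [f [u ->]]]|[c ->]].
    elim/big_rec: _ => [|i z _ zx]; first exact: combination0.
    apply: combinationD => //; have [a ->] := pG (u i).
    have -> : f i (a *: p) = a *: (e s *: f i p) by rewrite -linearZ ep linearZ.
    exact: combinationZ.
  have fex i : exists f : {linear Pmod e s -> N},
      forall a : R, f (a *: p) = a *: x i.
    apply: cyclic_linear => // a /p0/idem_ideal_set0 ae.
    by rewrite -xs scalerA ae scale0r.
  have [f fE] := choice fex.
  apply/asboolP; exists n, f, (fun i => c i *: p).
  by apply: eq_bigr => i _; rewrite fE.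
have [t [tI tE]] := submod_of_ex (trace (Pmod e s) N).
have hex (c : {ffun 'I_n -> Pmod e s}) :
    exists z, t z = \sum_i (j (c i) : R) *: x i.
  by apply/tE/traceP; exists (fun i => j (c i)).
have [h0 h0E] := choice hex.
have [|h hE] := @linear_ex R {ffun 'I_n -> Pmod e s}
    (submod_of (trace (Pmod e s) N)) h0.
  move=> a c d; apply: tI; rewrite linearP !h0E scaler_sumr -big_split.
  apply: eq_bigr => i _; rewrite !ffunE linearP scalerDl.
  by rewrite scalerA.
have thE c : t (h c) = \sum_i (j (c i) : R) *: x i by rewrite hE.
apply: mod_iso_sym; apply: (bij_mod_iso (f := h)).
  apply: linear_inj0 => c /(congr1 t); rewrite linear0 thE => /xfree c0.
  apply/ffunP => i; rewrite ffunE; apply: jI; rewrite linear0 -(c0 i).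
  by apply/esym/jE; exists (c i).
move=> y; have [c cE] : combination x (t y) by apply/traceP/tE; exists y.
have dex i : exists z : Pmod e s, j z = c i * e s.
  by apply/jE; rewrite -mulrA eI.
have [d dE] := choice dex.
exists [ffun i => d i]; apply: tI; rewrite thE cE; apply: eq_bigr => i _.
by rewrite ffunE dE -scalerA xs.
Qed.

(** A nonzero free trace has a summand, and the inclusion of that summand is the embedding. *)
Lemma trace_embedding (N : lmodType R) n :
  mod_iso (submod_of (trace (Pmod e s) N)) {ffun 'I_n -> Pmod e s} ->
  (exists2 x, x \in trace (Pmod e s) N & x != 0) ->
  (exists z : Pmod e s, z != 0) /\ exists g : {linear Pmod e s -> N}, injective g.
Proof.
move=> [h [h' hK h'K]] [x xT x0].
have [t [tI tE]] := submod_of_ex (trace (Pmod e s) N).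
have [y yE] := (tE x).1 xT.
have [i hi] : exists i, h y i != 0.
  apply: contrapT => nex; case/eqP: x0; rewrite -yE -[y]hK.
  have -> : h y = h 0.
    apply/ffunP => i; rewrite linear0 ffunE; apply/eqP; apply: contraPT isT => hi.
    by move=> _; apply: nex; exists i.
  by rewrite hK linear0.
split; first by exists (h y i).
have hS z : exists w, h w = z by exists (h' z).
have [h'' [_ h''K]] := linear_inv (can_inj hK) hS.
have [|g gE] := @linear_ex R (Pmod e s) N
    (fun z => t (h'' [ffun l => if l == i then z else 0])).
  move=> a z w; rewrite -linearP -linearP; congr (t (h'' _)).
  by apply/ffunP => l; rewrite !ffunE; case: eqP => // _; rewrite scaler0 addr0.
exists g => z w; rewrite !gE => /tI/(can_inj h''K)/ffunP/(_ i).
by rewrite !ffunE eqxx.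
Qed.

End Traces.

(** * A nonzero top factor *)

Section TopFactor.
Variables (Lam : finType) (R : pzRingType) (e : Lam -> R) (le : rel Lam).

(** The form of [filt] allows a zero top factor, namely when [v] lies in [f L]. Then [f] is onto and
    the search goes on in [L], ending because the module is nonzero. *)
Lemma filt_top (N : lmodType R) : filt e le N -> forall x : N, x <> 0 ->
  exists m (K : submodClosed N) (w : N),
  [/\ w \notin K, forall y, exists a : R, y - a *: w \in K
    & forall a : R, a *: w \in K <-> idem_ideal e (above le m) (a * e m)].
Proof.
elim=> {N} [N N0 x /(_ (N0 x)) []|L N f m v fI _ IH vS vU x x0].
have image (P : L -> Prop) : P 0 -> (forall y z, P y -> P z -> P (y + z)) ->
    (forall a y, P y -> P (a *: y)) ->
    exists K : submodClosed N, forall z, z \in K <-> exists2 y, P y & z = f y.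
  move=> P0 PD PZ; apply: submod_ex.
  - by exists 0; rewrite ?linear0.
  - move=> _ _ [y yP ->] [z zP ->].
    by exists (y + z); [apply: PD|rewrite linearD].
  - by move=> a _ [y yP ->]; exists (a *: y); [apply: PZ|rewrite linearZ].
have [[y0 vE]|vN] := pselect (exists y, v = f y).
  have fS z : exists y, f y = z.
    have [a [y ->]] := vS z; exists (a *: y0 + y).
    by rewrite linearD linearZ /= vE.
  have [y yE] := fS x.
  have [|m' [K [w [wK wG wI]]]] := IH y.
    by move=> y0'; apply: x0; rewrite -yE y0' linear0.
  have [|z t zK tK|a z zK|K' K'P] := image (fun z => z \in K).
  - exact: rpred0.
  - exact: rpredD.
  - exact: rpredZ.
  have fK z : f z \in K' <-> z \in K.
    by rewrite K'P; split=> [[t tK /fI ->]|zK] //; exists z.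
  exists m', K', (f w); split; first by apply: contraNN wK => /fK.
    move=> z; have [t <-] := fS z; have [a aK] := wG t; exists a.
    by rewrite -linearZ -linearB; apply/fK.
  by move=> a; rewrite -linearZ fK.
have [|||K KP] := image (fun=> True) => //.
exists m, K, v; split.
- by apply/negP => /KP[y _ vE]; apply: vN; exists y.
- move=> z; have [a [y ->]] := vS z; exists a.
  by rewrite addrC addKr; apply/KP; exists y.
- move=> a; rewrite -vU; split=> [/KP[y _ ->]|[y yE]]; first by exists y.
  by apply/KP; exists y.
Qed.

End TopFactor.

(** * The projection onto the quotient ring *)

Section QuotRingMap.
Variables (R : pzRingType) (f : R).

Definition quot_ring_map (x : R) : quot_ring f := \pi_(quot_ring f) x.

Fact quot_ring_map_zmod : zmod_morphism quot_ring_map.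
Proof.
move=> x y; rewrite /quot_ring_map; apply/esym/eqP.
by rewrite subr_eq -quot_ringD subrK.
Qed.
Fact quot_ring_map_monoid : monoid_morphism quot_ring_map.
Proof. by split=> // x y; rewrite /quot_ring_map -quot_mulE. Qed.
HB.instance Definition _ :=
  GRing.isZmodMorphism.Build R (quot_ring f) quot_ring_map quot_ring_map_zmod.
HB.instance Definition _ :=
  GRing.isMonoidMorphism.Build R (quot_ring f) quot_ring_map quot_ring_map_monoid.

Lemma quot_ring_map_eq0 x : quot_ring_map x = 0 <-> x \in two_sided_ideal f.
Proof.
rewrite -{2}[x]subr0 quot_ringP -/(quot_ring_map x) -/(quot_ring_map 0) rmorph0.
by split=> [->|/eqP].
Qed.

Lemma quot_ring_map_surj y : exists x, quot_ring_map x = y.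
Proof. by exists (repr y); rewrite /quot_ring_map reprK. Qed.

End QuotRingMap.

(** * A run of the algorithm down the given order *)

Section Algorithm.
Variables (Lam : finType) (k : fieldType) (A : falgType k) (e : Lam -> A).
Variable le : rel Lam.
Hypothesis eI : forall l, e l * e l = e l.
Hypothesis eL : forall l, local_idem (e l).
Hypothesis hle : linear_order le.
Hypothesis hbasic : basic e.
Hypothesis hcoker : catF_closed_coker e le.

Lemma fin_gen_cyclic (M : lmodType A) (v : M) : generates v -> fin_gen M.
Proof.
move=> vG; exists 1%N, (fun=> v) => x; have [a ->] := vG x.
by exists (fun=> a); rewrite big_ord1.
Qed.

Lemma filt_coker (L M N : lmodType A) (u : L) (v : M)
    (f : {linear L -> M}) (g : {linear M -> N}) :
  generates u -> generates v -> filt e le L -> filt e le M -> injective f ->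
  (forall y, exists x, g x = y) -> (forall y, g y = 0 <-> exists x, f x = y) ->
  filt e le N.
Proof.
move=> uG vG fL fM fI gS g0.
have gG : generates (g v).
  move=> y; have [x <-] := gS y; have [a ->] := vG x.
  by exists a; rewrite linearZ.
have catFP (Q : lmodType A) (w : Q) : generates w -> filt e le Q -> catF e le Q.
  by move=> wG fQ; split; [apply: fin_gen_cyclic wG|apply: filt_std_filtered].
have [_ Nstd] := hcoker (fin_gen_cyclic gG) (And3 fI gS g0) (catFP _ _ uG fL)
  (catFP _ _ vG fM).
exact: (std_filtered_filt eI eL hle Nstd).
Qed.

(* The cokernel, if nonzero, lies in F(Delta) and is local with top [S_s], so it
   surjects onto [Delta_s = M], of which it is a proper quotient. *)
Lemma embedding_eq m s (L M : lmodType A) (u : L) (v : M) (f : {linear L -> M}) :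
  cyclic_at e (above le s) m u -> cyclic_at e (above le s) s v ->
  filt e le L -> filt e le M -> injective f -> u <> 0 -> m = s.
Proof.
move=> uC vC fL fM fI u0; have [uG uU] := uC; have [vG vU] := vC.
have eu := cyclic_at_idem eI uC; have ev := cyclic_at_idem eI vC.
have [b fu] := vG (f u).
(* If [f] is onto, [f u] and [v] generate each other, and the comparison of tops with [K = 0]
   applies. *)
have [[y yE]|vN] := pselect (exists y, v = f y).
  have [c cE] := uG y.
  have [Z ZP] : exists Z : submodClosed M, forall x, x \in Z <-> x = 0.
    apply: submod_ex => // [x z -> ->|a x ->]; first exact: addr0.
    exact: scaler0.
  have [||||iso _] := local_top_iso (K := Z) (m := m) (v := f u) (b := b) (c := c)
    eI eL ev.
  - by apply/ZP; rewrite -linearZ eu subrr.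
  - by apply/ZP; rewrite fu subrr.
  - by apply/ZP; rewrite yE cE linearZ subrr.
  - by apply/negP => /ZP; rewrite -(linear0 f) => /fI.
  exact: hbasic iso.
have [|x y [x' <-] [y' <-]|a x [x' <-]|N [g [gS g0]]] :=
  @quot_mod_ex _ M (fun y => exists x, f x = y).
- by exists 0; rewrite linear0.
- by exists (x' + y'); rewrite linearD.
- by exists (a *: x'); rewrite linearZ.
have gv : g v <> 0 by move=> /g0[y yE]; apply: vN; exists y.
have [m' [K [w [wK wG wI]]]] := filt_top (filt_coker uG vG fL fM fI gS g0) gv.
have [c cK] := wG (g v); have [x xE] := gS w; have [d dE] := vG x.
have egv : e s *: g v = g v by rewrite -linearZ ev.
have [||iso [z zE]] := local_top_iso (K := K) (m := m') (v := w) (b := d) (c := c)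
  eI eL egv _ _ cK wK.
- have /wI : idem_ideal e (above le m') ((e m' - 1) * e m').
    by rewrite mulrBl mul1r eI subrr; apply: idem_ideal0.
  by rewrite scalerBl scale1r.
- by rewrite -xE dE linearZ subrr rpred0.
have m's : m' = s := hbasic iso.
(* The composite of [M -> N -> N/K] kills [f u = b *: v], so [b * e s * c] lies in the ideal of
   [above s] once cut by [e s]. As [e s * c * e s] has right inverse [z], so does [b * e s], and
   [f u] is zero. *)
subst m'; case: u0; apply: fI; rewrite linear0 fu; apply/vU.
rewrite -zE !mulrA; apply: idem_idealMr; apply/wI.
have bgv : b *: g v = 0 by rewrite -linearZ; apply/g0; exists u.
have -> : (b * e s * c) *: w = - ((b * e s) *: (g v - c *: w)).
  by rewrite scalerBr -(scalerA b _ (g v)) egv bgv sub0r opprK scalerA.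
by rewrite -scaleN1r !rpredZ.
Qed.

(** Invariant of the run: through [phi], the current algebra [R] is A modulo the idempotents outside
    [J], and its projectives are filtered over A. [R] and [phi] are arbitrary because each step
    changes the quotient type. *)
Lemma algorithm_run_sorted (s : seq Lam) (J : {set Lam}) (R : pzRingType)
    (phi : {rmorphism A -> R}) :
  (forall y, exists x, phi x = y) ->
  (forall x, phi x = 0 <-> idem_ideal e (~: J) x) ->
  uniq s -> s =i J -> sorted (fun l m => le m l) s ->
  (forall l m, l \in J -> m \notin J -> le l m) ->
  (forall l, exists (M : lmodType A) (v : M),
     filt e le M /\ cyclic_at e (~: J) l v) ->
  algorithm_run s (fun l => phi (e l)) J.
Proof.
have [le_refl le_anti le_trans le_total] := hle.
have le_tot l m : l != m -> ~~ le l m -> le m l.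
  by move=> _ lm; have := le_total l m; rewrite (negPf lm).
elim: s J R phi => [|s s' IH] J R phi phiS phi0 us sJ sorteds Jlow filtJ.
  apply/setP => l; rewrite !inE; apply/negP => /andP[lJ _].
  by have := sJ l; rewrite lJ in_nil.
have sJ1 : s \in J by rewrite -sJ mem_head.
have smax m : m \in J -> le m s.
  rewrite -sJ inE => /orP[/eqP -> //|ms'].
  have := order_path_min _ sorteds => /(_ _)/allP; apply=> //.
  by move=> x y z yx zx; apply: le_trans zx yx.
(* The indices already removed are exactly those above the head of the chain, so here Delta_s is the
   projective at [s] over [R]. *)
have JE : ~: J = above le s.
  apply/setP => m; rewrite !inE; apply/idP/andP => [mJ|[sm ms]].
    by split; [apply: Jlow|apply: contraNneq mJ => ->].
  apply: contraNN ms => mJ; apply/eqP/le_anti; rewrite smax //.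
pose e' l := phi (e l).
have e'I l : e' l * e' l = e' l by rewrite /e' -rmorphM eI.
(* The dictionary between [M] over A and [P_m] over [R]: the generators [v] and [e' m] have the same
   annihilator. *)
have lift (M : lmodType A) (v : M) m a : cyclic_at e (~: J) m v ->
    a *: v = 0 <-> phi a * e' m = 0.
  by case=> _ ->; rewrite -phi0 rmorphM.
have sO1 : s \in O1 e' J.
  rewrite inE sJ1; apply/asboolP => m mJ.
  have [M [v [fM vC]]] := filtJ m.
  have Mk : killed e (above le s) M by rewrite -JE; apply: cyclic_at_killed vC.
  have [n [x [[xs xspan xfree] _]]] := filt_trace eI le_tot fM Mk; exists n.
  have [b bE] := choice (fun i => vC.1 (x i)).
  have [j [jI jE]] := Pmod_ex (e'I m).
  (* [X i] is the counterpart over [R] of [x i = b i *: v]; [jsum] carries linear relations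
     across. *)
  have X_ex i : exists X : Pmod e' m, j X = phi (b i) * e' m.
    by apply/jE; rewrite -mulrA e'I.
  have [X XE] := choice X_ex.
  have jsum (c : 'I_n -> A) (a : A) :
      j (\sum_i phi (c i) *: X i) = (phi a * e' m : R^o) <->
      \sum_i c i *: x i = a *: v.
    have -> : j (\sum_i phi (c i) *: X i) = phi (\sum_i c i * b i) * e' m.
      rewrite linear_sum rmorph_sum mulr_suml; apply: eq_bigr => i _.
      by rewrite linearZ /= XE rmorphM -mulrA.
    have -> : \sum_i c i *: x i = (\sum_i c i * b i) *: v.
      by rewrite scaler_suml; apply: eq_bigr => i _; rewrite bE scalerA.
    split=> [|/eqP]; last first.
      rewrite -subr_eq0 -scalerBl => /eqP/(lift _ _ _ _ vC).
      by rewrite rmorphB mulrBl => /subr0_eq.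
    move/eqP; rewrite -subr_eq0 -mulrBl -rmorphB => /eqP/(lift _ _ _ _ vC).
    by rewrite scalerBl => /subr0_eq.
  have Xsum (c : 'I_n -> R) : exists c' : 'I_n -> A, forall i, c i = phi (c' i).
    have [c' c'E] := choice (fun i => phiS (c i)).
    by exists c' => i; rewrite c'E.
  apply: (trace_basis_iso e'I (x := X)).
  - move=> i; apply: jI; rewrite linearZ /= XE.
    have := lift _ _ _ (e s * b i - b i) vC.
    rewrite scalerBl -scalerA -bE xs subrr rmorphB rmorphM mulrBl.
    by move=> [/(_ erefl)/subr0_eq + _]; rewrite -mulrA.
  - move=> y; have [a aE] := phiS (j y).
    have yE : (phi a * e' m : R^o) = j y.
      by rewrite aE; apply/jE; exists y.
    have [c cE] := xspan (a *: v).
    exists (fun i => phi (c i)); apply: jI; apply/esym.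
    rewrite linearZ /= -yE.
    have -> : e' s *: (phi a * e' m : R^o) = phi (e s * a) * e' m.
      by rewrite rmorphM -mulrA.
    by apply/jsum; rewrite -cE scalerA.
  - move=> c c0 i; have [c' c'E] := Xsum c.
    rewrite c'E -rmorphM; apply/phi0; rewrite JE; apply: xfree.
    rewrite -[RHS](scale0r v); apply/jsum; rewrite rmorph0 mul0r.
    have -> : \sum_i phi (c' i) *: X i = 0; last exact: linear0.
    by rewrite -[RHS]c0; apply: eq_bigr => l _; rewrite c'E.
split.
  split=> // m; rewrite inE => /andP[mJ /asboolP mO1] mle.
  have [n mn] := mO1 s sJ1.
  have [[z z0] [g gI]] := trace_embedding mn mle.
  have [p pC] := Pmod_cyclic_at (e'I m); have [pG p0] := pC.
  have [j [jI jE]] := Pmod_ex (e'I s).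
  have [y0 y0E] := phiS (j (g p)).
  have [L [u [fL uC]]] := filtJ m; have [M [v [fM vC]]] := filtJ s.
  (* [y0] lifts the image of the generator of [P_m] under [g], so [u |-> y0 *: v] is the embedding
     [g] seen over A. *)
  have uv (a : A) : a *: u = 0 <-> a *: (y0 *: v) = 0.
    rewrite scalerA (lift _ _ _ _ vC) (lift _ _ _ _ uC) rmorphM y0E.
    have -> : phi a * j (g p) * e' s = j (g (phi a *: p)).
      rewrite !linearZ /= -mulrA; congr (_ * _).
      by apply/jE; exists (g p).
    have -> : j (g (phi a *: p)) = 0 <-> phi a *: p = 0.
      split=> [|->]; last by rewrite !linear0.
      by rewrite -(linear0 j) => /jI; rewrite -(linear0 g) => /gI.
    rewrite p0; split=> [->|/idem_ideal_set0 //]; exact: idem_ideal0.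
  have [|f fE] := cyclic_linear (v := y0 *: v) uC.1; first by move=> a /uv.
  have fI : injective f.
    apply: linear_inj0 => t; have [a ->] := uC.1 t.
    by rewrite fE => /uv.
  rewrite JE in uC vC.
  apply: (embedding_eq uC vC fL fM fI) => u0; case/eqP: z0.
  have : phi 1 * e' m = 0.
    by apply/(lift _ u); rewrite ?JE // u0 scaler0.
  rewrite rmorph1 mul1r => em0; have [a ->] := pG z.
  by apply/p0; rewrite em0 mulr0; apply: idem_ideal0.
pose psi : {rmorphism A -> quot_ring (e' s)} :=
  [the {rmorphism A -> _} of quot_ring_map (e' s) \o phi].
have JsE : ~: (J :\ s) = s |: above le s.
  by rewrite -JE; apply/setP => l; rewrite !inE negb_and negbK.
case/andP: us => ss' us'.
apply: (IH (J :\ s) _ psi) => //.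
- move=> y; have [x <-] := quot_ring_map_surj y; have [t <-] := phiS x.
  by exists t.
- move=> x; rewrite JsE /= quot_ring_map_eq0; split=> [/asboolP[n [a [b xE]]]|xI].
    have [a' a'E] := choice (fun i => phiS (a i)).
    have [b' b'E] := choice (fun i => phiS (b i)).
    rewrite -[x](subrK (\sum_i a' i * e s * b' i)); apply: idem_idealD.
      apply: (idem_idealS (U := ~: J)).
        by move=> l lJ; rewrite -JE !inE in lJ *; rewrite lJ orbT.
      apply/phi0; rewrite rmorphB xE rmorph_sum -sumrB big1 // => i _.
      by rewrite !rmorphM a'E b'E subrr.
    apply: idem_ideal_sum => i; apply: idem_ideal_gen.
    by rewrite !inE eqxx.
  elim: xI => [|y z _ IHy _ IHz|l a b]; first by rewrite rmorph0 rpred0.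
    by rewrite rmorphD rpredD.
  case/setU1P => [->|lJ].
    apply/asboolP; exists 1%N, (fun=> phi a), (fun=> phi b).
    by rewrite big_ord1 !rmorphM.
  suff /phi0 -> : idem_ideal e (~: J) (a * e l * b) by rewrite rpred0.
  by apply: idem_ideal_gen; rewrite JE.
- move=> l; rewrite !inE -sJ inE; case: eqVneq => [->|] //=.
  exact: negPf ss'.
- exact: path_sorted sorteds.
- move=> l m; rewrite !inE negb_and negbK => /andP[ls lJ] /orP[/eqP ->|mJ].
    exact: smax.
  exact: Jlow.
move=> l; have [M [v [fM vC]]] := filtJ l; rewrite JE in vC.
by rewrite JsE; apply: filt_truncate vC.
Qed.

End Algorithm.

Theorem proposition4p2 (k : closedFieldType) (A : falgType k) (Lam : finType)
    (e : Lam -> A) (le : rel Lam)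
    (he : complete_primitive_idems e)
    (hbasic : basic e)
    (hle : linear_order le)
    (hstrat : standardly_stratified e le)
    (hcoker : catF_closed_coker e le) :
  calL e le.
Proof.
have [eP _ _] := he.
have eI l : e l * e l = e l by have [] := eP l.
have eL l : local_idem (e l) by apply: primitive_local.
have [le_refl le_anti le_trans le_total] := hle.
pose ge := fun l m => le m l.
have ge_trans : transitive ge by move=> x y z yx zx; apply: le_trans zx yx.
pose s := sort ge (enum Lam).
have s_sorted : sorted ge s by apply: sort_sorted => l m; apply: le_total.
have s_all l : l \in s by rewrite mem_sort mem_enum.
exists s; split.
- apply: (@algorithm_run_sorted _ _ _ e le eI eL hle hbasic hcoker s [set: Lam] A
    [the {rmorphism A -> A} of idfun]) => //.
  + by move=> y; exists y.
  + move=> x; rewrite setCT /=; split=> [->|/idem_ideal_set0 //].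
    exact: idem_ideal0.
  + by rewrite sort_uniq enum_uniq.
  + by move=> l; rewrite s_all inE.
  + by move=> l m _; rewrite inE.
  (* Before any removal the invariant is standard stratification: [P_l] is Delta_l on top of its
     filtered kernel. *)
  move=> l; rewrite setCT; have [p pC] := Pmod_cyclic_at (eI l).
  exists (Pmod e l), p; split=> //.
  have [f [fI fE]] := submod_of_ex (std_kernel e le l).
  have stdK a := std_kernelP eI eL hle a pC.
  apply: (filt_step (f := f) (m := l) (v := p)) => //.
  + exact: (std_filtered_filt eI eL hle (hstrat l)).
  + by move=> x; have [a ->] := pC.1 x; exists a, 0; rewrite linear0 addr0.
  + by move=> a; rewrite -stdK fE; split=> -[y]; exists y.
- by rewrite size_sort -cardE.
move=> l m; rewrite /chain_order !s_all /=; apply/idP/idP => [lm|ml].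
  rewrite leqNgt; apply/negP => llm.
  have ml : ge l m.
    by apply: (sorted_leq_index ge_trans le_refl s_sorted) => //; apply: ltnW.
  have : l = m by apply: le_anti; rewrite lm.
  by move=> lmE; rewrite lmE ltnn in llm.
exact: (sorted_leq_index ge_trans le_refl s_sorted).
Qed.
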